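(* Let $E\subset\mathbb R^2$ be a set (not necessarily closed) whose projection to each coordinate direction has $1$-dimensional Lebesgue measure zero. Then $E\in\mathrm{NED}^w$. If, in addition, $m_2(\overline E)=0$, then $E\in\mathrm{NED}$.
   Context: Here the dimension is $n=2$ and $m_2$ is Lebesgue measure in $\mathbb R^2$. A path (or curve) in $\mathbb R^2$ is a continuous map $\gamma\colon I\to\mathbb R^2$ with $I\subset\mathbb R$ a compact interval; its trace is $|\gamma|=\gamma(I)$. For a family $\Gamma$ of curves in $\mathbb R^2$, $\mathrm{Mod}_2\Gamma=\inf_\rho\int_{\mathbb R^2}\rho^2$, the infimum over all Borel functions $\rho\colon\mathbb R^2\to[0,\infty]$ with $\int_\gamma\rho\,ds\ge1$ for every rectifiable $\gamma\in\Gamma$ ($\mathrm{Mod}_2\Gamma=\infty$ if there are none). A continuum is a compact connected set. $\Gamma(F_1,F_2;\mathbb R^2)$ is the family of curves $\gamma\colon[a,b]\to\mathbb R^2$ with $\gamma(a)\in F_1$, $\gamma(b)\in F_2$. For $E\subset\mathbb R^2$, $\mathcal F_0(E)$ is the family of curves that do not intersect $E$ except possibly at the endpoints (i.e. $\gamma\colon[a,b]\to\mathbb R^2$ with $(|\gamma|\setminus\{\gamma(a),\gamma(b)\})\cap E=\emptyset$). $E\in\mathrm{NED}$ if $\mathrm{Mod}_2\Gamma(F_1,F_2;\mathbb R^2)=\mathrm{Mod}_2(\Gamma(F_1,F_2;\mathbb R^2)\cap\mathcal F_0(E))$ for every pair of non-empty, disjoint continua $F_1,F_2\subset\mathbb R^2$.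 $E\in\mathrm{NED}^w$ if there is a constant $M\ge1$ such that $\mathrm{Mod}_2\Gamma(F_1,F_2;\mathbb R^2)\le M\cdot\mathrm{Mod}_2(\Gamma(F_1,F_2;\mathbb R^2)\cap\mathcal F_0(E))$ for every such pair. *)

(* Defs.v *)
From HB Require Import structures.
From mathcomp Require Import all_boot all_order all_algebra.
From mathcomp Require Import all_classical all_reals all_analysis measurable_realfun.

Set Implicit Arguments.
Unset Strict Implicit.
Unset Printing Implicit Defensive.

Import Order.TTheory GRing.Theory Num.Theory.
Import numFieldNormedType.Exports.

Local Open Scope classical_set_scope.
Local Open Scope ring_scope.

(* Two-dimensional Lebesgue measure.  Its domain, the product of the Borel
   sigma-algebras of R, is the Borel sigma-algebra of R * R. *)
Notation m2 R := (@lebesgue_measure R \x @lebesgue_measure R)%E.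

(* The library norm on R * R is the sup norm; arc length needs this one. *)
Definition euclidean_dist (R : realType) (x y : R * R) : R :=
  Num.sqrt ((x.1 - y.1) ^+ 2 + (x.2 - y.2) ^+ 2).

(* Only the restriction of curve_fun to [curve_lo, curve_hi] is meaningful. *)
Record curve (R : realType) := Curve {
  curve_lo : R;
  curve_hi : R;
  curve_fun :> R -> R * R;
  curve_lo_le_hi : curve_lo <= curve_hi;
  curve_continuous :
    {within `[curve_lo, curve_hi], continuous curve_fun}
}.

Section curves.
Context {R : realType}.
Implicit Types (g : curve R) (E F : set (R * R)).

Definition curve_start g : R * R := g (curve_lo g).
Definition curve_end g : R * R := g (curve_hi g).
Definition curve_trace g : set (R * R) := g @` `[curve_lo g, curve_hi g].

Definition path_variation (f : R -> R * R) (a b : R) (s : seq R) : R :=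
  \sum_(i < size s)
    euclidean_dist (f (nth b (a :: s) i)) (f (nth b (a :: s) i.+1)).

(* Partitions are those of the library: s excludes a and ends in b. *)
Definition path_length (f : R -> R * R) (a b : R) : \bar R :=
  ereal_sup [set (path_variation f a b s)%:E | s in itv_partition a b].

Definition curve_length g : \bar R := path_length g (curve_lo g) (curve_hi g).

Definition rectifiable g : Prop := (curve_length g < +oo)%E.

(* For g rectifiable and 0 <= s <= curve_length g, some parameter t satisfies
   "g restricted to [curve_lo g, t] has length s", and g takes the same value
   at all of them, so the choice made by xget is immaterial. *)
Definition arclength_param g (s : R) : R * R :=
  g (xget (curve_lo g) [set t | t \in `[curve_lo g, curve_hi g] /\
                                path_length g (curve_lo g) t = s%:E]).

Definition line_integral (rho : R * R -> \bar R) g : \bar R :=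
  (\int[@lebesgue_measure R]_(s in `[0%R, fine (curve_length g)])
     rho (arclength_param g s))%E.

Definition admissible (Gamma : set (curve R))
    (rho : R * R -> \bar R) : Prop :=
  [/\ measurable_fun [set: measurableTypeR R * measurableTypeR R] rho,
      (forall x, 0 <= rho x)%E &
      forall g, Gamma g -> rectifiable g -> (1 <= line_integral rho g)%E].

Definition Mod2 (Gamma : set (curve R)) : \bar R :=
  ereal_inf [set (\int[m2 R]_x (rho x ^+ 2))%E | rho in admissible Gamma].

Definition continuum F : Prop := compact F /\ connected F.

Definition joining F1 F2 : set (curve R) :=
  [set g | F1 (curve_start g) /\ F2 (curve_end g)].

Definition avoiding E : set (curve R) :=
  [set g | (curve_trace g `\` [set curve_start g; curve_end g]) `&` E = set0].

Definition disjoint_continua F1 F2 : Prop :=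
  [/\ continuum F1, continuum F2, F1 !=set0, F2 !=set0 & F1 `&` F2 = set0].

Definition NED E : Prop :=
  forall F1 F2, disjoint_continua F1 F2 ->
    Mod2 (joining F1 F2) = Mod2 (joining F1 F2 `&` avoiding E).

Definition NEDw E : Prop :=
  exists M : R, 1 <= M /\
    forall F1 F2, disjoint_continua F1 F2 ->
      (Mod2 (joining F1 F2) <= M%:E * Mod2 (joining F1 F2 `&` avoiding E))%E.

End curves.

(* Main.v *)
From HB Require Import structures.
Require Import Defs.
From mathcomp Require Import all_boot all_order all_algebra.
From mathcomp Require Import all_classical all_reals all_analysis measurable_realfun.
From mathcomp Require Import ring lra.
Import Order.TTheory GRing.Theory Num.Theory.
Import numFieldNormedType.Exports.
Set Implicit Arguments.
Unset Strict Implicit.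
Unset Printing Implicit Defensive.
Local Open Scope classical_set_scope.
Local Open Scope ring_scope.

(** The point is that almost every horizontal and almost every vertical line
   misses E, so that there are enough curves off E to control all curves.

   Let rho be admissible for the curves that join F1 to F2 and avoid E, with
   finite energy. The potential u of rho, that is the infimum of the line
   integrals of rho over the curves from F1 that avoid E, vanishes on F1 off E,
   equals 1 on F2 off E after truncation, and has rho as an upper gradient along every segment
   off E (potential_line_bounded). It is measurable because it is continuous
   along almost every line (good_representative).

   Average u over squares of half-side r. Over a short distance the increment of
   the average is bounded by the average of the increments (sq_avg_step). A
   translate of the segment which is far from E contributes the integral of rho
   along it. One which comes close to E is replaced by two axis-parallel segments
   on lines that miss E, and contributes the integrals of rho along them: this
   costs a factor at most 3, and only in a neighbourhood N of E. Hence the average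
   of rho + 2 * rho \_ N over slightly larger squares is an upper gradient of the
   average of u along every rectifiable curve (increment_along_short_map), and by
   Cauchy-Schwarz its energy is close to that of rho + 2 * rho \_ N
   (sqr_sq_mass_integral).

   The averages keep the boundary values as r tends to 0. A nondegenerate
   continuum meets the boundary of every small square centered at one of its
   points, and almost every such boundary lies on lines that miss E, so u
   oscillates on it by at most the integral of rho along it. Integrated over the
   sizes of the squares, this bounds the deviation from the boundary value by the
   L2 norm of rho on a small square (boundary_average), which is uniformly small.
   So Mod2 (joining F1 F2) is at most the energy of rho + 2 * rho \_ N, up to a
   factor close to 1 (joining_modulus_le). If F1 or F2 is a point then this modulus
   is 0, because points have capacity zero in the plane (Mod2_through_point).

   With N the whole plane this compares the two moduli up to a constant. If the
   closure of E is null, the neighbourhoods N shrink to a null set, the extra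
   energy on N tends to 0, and the two moduli agree. *)


(** * Length of planar paths *)

Section path_length_theory.
Context {R : realType}.
Implicit Types (x y z : R * R) (f : R -> R * R) (a b c : R).

Lemma edist_ge0 x y : 0 <= euclidean_dist x y.
Proof. exact: sqrtr_ge0. Qed.

Lemma edistC x y : euclidean_dist x y = euclidean_dist y x.
Proof. by rewrite /euclidean_dist; congr Num.sqrt; ring. Qed.

Lemma edistxx x : euclidean_dist x x = 0.
Proof. by rewrite /euclidean_dist !subrr expr0n addr0 sqrtr0. Qed.

Lemma edist_fst x y : `|x.1 - y.1| <= euclidean_dist x y.
Proof.
by rewrite /euclidean_dist -sqrtr_sqr ler_wsqrtr// lerDl sqr_ge0.
Qed.

Lemma edist_snd x y : `|x.2 - y.2| <= euclidean_dist x y.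
Proof.
by rewrite /euclidean_dist -sqrtr_sqr ler_wsqrtr// lerDr sqr_ge0.
Qed.

Lemma edist_eq0 x y : euclidean_dist x y <= 0 -> x = y.
Proof.
move=> d0; have := le_trans (edist_fst x y) d0.
have := le_trans (edist_snd x y) d0.
rewrite !normr_le0 !subr_eq0 => /eqP + /eqP.
by case: x y {d0} => [x1 x2] [y1 y2] /= -> ->.
Qed.

Lemma edist_le_l1 x y : euclidean_dist x y <= `|x.1 - y.1| + `|x.2 - y.2|.
Proof.
rewrite /euclidean_dist -[leRHS]ger0_norm ?addr_ge0// -sqrtr_sqr ler_wsqrtr//.
by rewrite [leRHS]sqrrD !real_normK ?num_real// lerD2r lerDl mulrn_wge0// mulr_ge0.
Qed.

Lemma edist_triangle x y z :
  euclidean_dist x z <= euclidean_dist x y + euclidean_dist y z.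
Proof.
rewrite /euclidean_dist.
set p := x.1 - y.1; set q := x.2 - y.2; set r := y.1 - z.1; set s := y.2 - z.2.
have -> : x.1 - z.1 = p + r by rewrite /p /r; ring.
have -> : x.2 - z.2 = q + s by rewrite /q /s; ring.
have A0 : 0 <= p ^+ 2 + q ^+ 2 by rewrite addr_ge0 ?sqr_ge0.
have B0 : 0 <= r ^+ 2 + s ^+ 2 by rewrite addr_ge0 ?sqr_ge0.
rewrite -[leRHS]ger0_norm ?addr_ge0 ?sqrtr_ge0// -sqrtr_sqr ler_wsqrtr//.
rewrite [leRHS]sqrrD !sqr_sqrtr// -sqrtrM//.
suff : p * r + q * s <= Num.sqrt ((p ^+ 2 + q ^+ 2) * (r ^+ 2 + s ^+ 2)) by nra.
rewrite (le_trans (ler_norm _))// -sqrtr_sqr ler_wsqrtr//.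
by rewrite -subr_ge0 (_ : _ - _ = (p * s - q * r) ^+ 2) ?sqr_ge0//; ring.
Qed.

(** A recursive form of path_variation, for inductions on the partition; it
   does not depend on the right end of the interval. *)
Fixpoint chain_length f a (s : seq R) : R :=
  if s is x :: s' then euclidean_dist (f a) (f x) + chain_length f x s' else 0.

Lemma path_variationE f a b s : path_variation f a b s = chain_length f a s.
Proof.
elim: s a => [|x s IH] a; first by rewrite /path_variation big_ord0.
rewrite /path_variation /= big_ord_recl /=; congr (_ + _).
by rewrite -IH.
Qed.

Lemma chain_length_cat f a s t :
  chain_length f a (s ++ t) = chain_length f a s + chain_length f (last a s) t.
Proof. by elim: s a => [|x s IH] a /=; rewrite ?add0r// IH addrA. Qed.

(** Inserting b into the partition does not shorten it, by the triangle
   inequality; the refined partition splits at b. *)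
Lemma chain_length_insert f a b c s : a < b -> b < c -> itv_partition a c s ->
  exists s1 s2, [/\ itv_partition a b s1, itv_partition b c s2 &
    chain_length f a s <= chain_length f a s1 + chain_length f b s2].
Proof.
elim: s a => [|x s IH] a ab bc.
  by move=> /itv_partition_nil ac; move: ab; rewrite ac ltNge (ltW bc).
move=> /[dup] [[/= /andP[ax _] _]] /itv_partition_cons xs.
have [xb|bx|xb] := ltgtP x b.
- have [s1 [s2 [p1 p2 le12]]] := IH _ xb bc xs.
  exists (x :: s1), s2; split => //=; last by rewrite -addrA lerD2l.
  by case: p1 => p1 l1; split => //=; rewrite ax.
- exists [:: b], (x :: s); split; first exact: itv_partition1.
    by case: xs => p1 l1; split => //=; rewrite bx.
  by rewrite /= addr0 addrA lerD2r edist_triangle.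
- exists [:: b], s; rewrite -xb; split => //=; first exact: itv_partition1.
  by rewrite addr0.
Qed.

Lemma path_lengthxx f a : path_length f a a = 0%E.
Proof.
rewrite /path_length (_ : [set _ | _ in _] = [set 0%E]) ?ereal_sup1//.
apply/seteqP; split=> [_ [s /itv_partitionxx -> <-]|_ ->] /=.
  by rewrite path_variationE.
by exists [::]; [split => /= | rewrite path_variationE].
Qed.

Lemma path_length_ub f a b s : itv_partition a b s ->
  ((chain_length f a s)%:E <= path_length f a b)%E.
Proof.
by move=> h; apply: ereal_sup_ubound; exists s => //; rewrite path_variationE.
Qed.

Lemma path_length_lub f a b (M : \bar R) :
  (forall s, itv_partition a b s -> ((chain_length f a s)%:E <= M)%E) ->
  (path_length f a b <= M)%E.
Proof.
by move=> h; apply: ge_ereal_sup => _ [s hs <-]; rewrite path_variationE h.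
Qed.

Lemma path_length_ge f a b : a <= b ->
  ((euclidean_dist (f a) (f b))%:E <= path_length f a b)%E.
Proof.
rewrite le_eqVlt => /predU1P[<-|ab]; first by rewrite path_lengthxx edistxx.
by have := path_length_ub f (itv_partition1 ab); rewrite /= addr0.
Qed.

Lemma path_length_ge0 f a b : a <= b -> (0 <= path_length f a b)%E.
Proof. by move=> ab; apply: le_trans (path_length_ge f ab); rewrite lee_fin edist_ge0. Qed.

Lemma path_lengthD f a b c : a <= b -> b <= c ->
  path_length f a c = (path_length f a b + path_length f b c)%E.
Proof.
rewrite le_eqVlt => /predU1P[<-|ab]; first by rewrite path_lengthxx add0e.
rewrite le_eqVlt => /predU1P[<-|bc]; first by rewrite path_lengthxx adde0.
apply/eqP; rewrite eq_le; apply/andP; split.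
  apply: path_length_lub => s /(chain_length_insert f ab bc)[s1 [s2 [p1 p2 le12]]].
  apply: le_trans (leeD (path_length_ub f p1) (path_length_ub f p2)).
  by rewrite -EFinD lee_fin.
have H s1 s2 : itv_partition a b s1 -> itv_partition b c s2 ->
    ((chain_length f a s1)%:E + (chain_length f b s2)%:E <= path_length f a c)%E.
  move=> p1 p2; apply: le_trans (path_length_ub f (itv_partition_cat p1 p2)).
  by rewrite chain_length_cat EFinD; case: p1 => _ /eqP ->.
have [->|] := eqVneq (path_length f a c) +oo%E; first by rewrite leey.
rewrite -ltey => Lfin.
have L0 : (path_length f a c \is a fin_num).
  by rewrite ge0_fin_numE// path_length_ge0// ltW// (lt_trans ab).
have H2 s2 : itv_partition b c s2 ->
    (path_length f a b <= path_length f a c - (chain_length f b s2)%:E)%E.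
  by move=> p2; apply: path_length_lub => s1 p1; rewrite leeBrDr// H.
have bfin : path_length f a b \is a fin_num.
  rewrite ge0_fin_numE ?path_length_ge0 ?ltW//.
  apply: le_lt_trans (H2 _ (itv_partition1 bc)) _.
  by rewrite -(fineK L0) -EFinB ltry.
rewrite addeC -leeBrDr//; apply: path_length_lub => s2 p2.
by rewrite leeBrDr// addeC -leeBrDr// H2.
Qed.

Lemma eq_path_length f g a b : a <= b -> {in `[a, b], f =1 g} ->
  path_length f a b = path_length g a b.
Proof.
move=> ab fg; rewrite /path_length; congr ereal_sup; apply: eq_imagel => s ps.
rewrite /path_variation; congr EFin; apply: eq_bigr => i _.
have H j : (j < (size s).+1)%N -> nth b (a :: s) j \in `[a, b].
  move=> js; rewrite in_itv /= itv_partition_nth_ge ?itv_partition_nth_le//.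
by rewrite !fg// H// ltnS// ltnW.
Qed.

End path_length_theory.

(** * Arc length parametrization *)

Section arclength.
Context {R : realType}.
Implicit Types (x y z : R * R) (f : R -> R * R) (a b c : R).

Lemma path_length_le_TV f a b : (path_length f a b <=
  total_variation a b (fst \o f) + total_variation a b (snd \o f))%E.
Proof.
apply: path_length_lub => s ps; rewrite -(path_variationE f a b).
apply: (@le_trans _ _ (variation a b (fst \o f) s + variation a b (snd \o f) s)%:E).
  rewrite lee_fin /path_variation /variation /= !big_mkord -big_split /=.
  by apply: ler_sum => i _; rewrite edistC edist_le_l1.
by rewrite EFinD; apply: leeD; apply: ereal_sup_ubound => /=;
   [exists (variation a b (fst \o f) s)|exists (variation a b (snd \o f) s)] => //;
   exact: variations_variation.
Qed.

Lemma TV_coord_le_path_length f (pr : R * R -> R) a b :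
  (forall x y, `|pr x - pr y| <= euclidean_dist x y) ->
  (total_variation a b (pr \o f) <= path_length f a b)%E.
Proof.
move=> prd; apply: ge_ereal_sup => _ [_ [s ps <-] <-].
apply: le_trans (path_length_ub f ps); rewrite -(path_variationE f a b) lee_fin.
rewrite /path_variation /variation /= big_mkord.
by apply: ler_sum => i _; rewrite edistC prd.
Qed.

Lemma path_length_le f a b c : a <= b -> b <= c ->
  (path_length f a b <= path_length f a c)%E.
Proof.
by move=> ab bc; rewrite (path_lengthD f ab bc) leeDl// path_length_ge0.
Qed.

Lemma path_length_fin f a b c : a <= b -> b <= c ->
  (path_length f a c < +oo)%E -> path_length f a b \is a fin_num.
Proof.
move=> ab bc L; rewrite ge0_fin_numE ?path_length_ge0//.
exact: le_lt_trans (path_length_le _ ab bc) L.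
Qed.

(** The length of an initial piece depends continuously on its end: its
   increments are dominated by those of the variations of both coordinates. *)
Lemma path_length_continuous f a b : a < b ->
  {within `[a, b], continuous f} -> (path_length f a b < +oo)%E ->
  {within `[a, b], continuous (fun t => fine (path_length f a t))}.
Proof.
move=> ab fc Lfin.
have TVc (pr : R * R -> R) : continuous pr ->
    (forall x y, `|pr x - pr y| <= euclidean_dist x y) ->
    {within `[a, b], continuous fine \o (total_variation a)^~ (pr \o f)} /\
    forall t, t \in `[a, b] -> total_variation a t (pr \o f) \is a fin_num.
  move=> prc prd.
  have H t : t \in `[a, b] -> total_variation a t (pr \o f) \is a fin_num.
    rewrite in_itv/= => /andP[at_ tb].
    rewrite ge0_fin_numE ?total_variation_ge0//.
    apply: le_lt_trans (TV_coord_le_path_length f a t prd) _.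
    by rewrite -ge0_fin_numE ?path_length_ge0// (path_length_fin _ tb).
  split=> //; apply: total_variation_continuous => //.
    by apply: within_continuous_comp => // x _; exact: prc.
  by apply/bounded_variationP => //; [exact: ltW | apply: H; rewrite in_itv/= lexx ltW].
have [c1 f1] := TVc fst (fun x => cvg_fst) edist_fst.
have [c2 f2] := TVc snd (fun x => cvg_snd) edist_snd.
apply/subspace_continuousP => x /= xab.
move/subspace_continuousP/(_ x xab) : c1 => /= c1.
move/subspace_continuousP/(_ x xab) : c2 => /= c2.
have c12 := cvgD (FF := within_filter _ (nbhs_filter x)) c1 c2.
apply/cvgrPdist_lt => e e0; move/cvgrPdist_lt/(_ e e0) : c12.
rewrite !near_withinE; apply: filterS => y /= H yab.
apply: le_lt_trans (H yab); rewrite /from_subspace /=.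
have key s t : s \in `[a, b] -> t \in `[a, b] -> s <= t ->
   `|fine (path_length f a t) - fine (path_length f a s)| <=
   (fine (total_variation a t (fst \o f)) + fine (total_variation a t (snd \o f)))
   - (fine (total_variation a s (fst \o f)) + fine (total_variation a s (snd \o f))).
  move=> /[dup] sab; rewrite in_itv/= => /andP[as_ sb].
  move=> /[dup] tab; rewrite in_itv/= => /andP[at_ tb] st.
  have Lt := path_length_fin at_ tb Lfin.
  have Ls := path_length_fin as_ sb Lfin.
  have Lst : path_length f s t \is a fin_num.
    move: Lt; rewrite (path_lengthD f as_ st) fin_numD => /andP[_ //].
  rewrite (path_lengthD f as_ st) fineD// addrAC subrr add0r ger0_norm; last first.
    by rewrite fine_ge0// path_length_ge0.
  have D pr : (forall t, t \in `[a, b] -> total_variation a t (pr \o f) \is a fin_num) ->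
      total_variation s t (pr \o f) \is a fin_num /\
      fine (total_variation a t (pr \o f)) - fine (total_variation a s (pr \o f))
        = fine (total_variation s t (pr \o f)).
    move=> pf; have := pf _ tab; rewrite (total_variationD _ as_ st) fin_numD => /andP[ps pst].
    by split => //; rewrite fineD// addrAC subrr add0r.
  have [g1 e1] := D _ f1; have [g2 e2] := D _ f2.
  rewrite opprD addrACA e1 e2 -fineD// fine_le ?fin_numD ?g1//.
  exact: path_length_le_TV.
have [xy|yx] := leP x y.
  by rewrite distrC (le_trans (key _ _ xab yab xy))// distrC ler_norm.
by rewrite (le_trans (key _ _ yab xab (ltW yx)))// ler_norm.
Qed.

Implicit Type g : curve R.

(** By continuity the length of the initial pieces takes the value s, so the
   choice in arclength_param never falls back on its default. *)
Lemma arclength_paramP g s : rectifiable g -> 0 <= s <= fine (curve_length g) ->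
  exists t, [/\ t \in `[curve_lo g, curve_hi g], arclength_param g s = g t &
                path_length g (curve_lo g) t = s%:E].
Proof.
move=> rg /andP[s0 sl]; rewrite /arclength_param.
set A := mkset _.
suff [t At] : exists t, A t by exists (xget (curve_lo g) A); have [] := xgetPex (curve_lo g) (ex_intro _ t At).
have := curve_lo_le_hi g; rewrite le_eqVlt => /predU1P[lohi|lohi].
  exists (curve_lo g); split; first by rewrite in_itv/= lexx -lohi lexx.
  move: sl; rewrite /curve_length -lohi !path_lengthxx /= => sl.
  by congr EFin; apply/eqP; rewrite eq_le s0 sl.
have c := path_length_continuous lohi (@curve_continuous _ g) rg.
have [|t tab tE] := IVT (v := s) (ltW lohi) c.
  rewrite path_lengthxx /=.
  have : 0 <= fine (path_length g (curve_lo g) (curve_hi g)) by rewrite fine_ge0// path_length_ge0// ltW.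
  by move=> h; rewrite (min_idPl h) (max_idPr h) s0.
exists t; split => //; rewrite -tE fineK//.
by move: tab; rewrite in_itv/= => /andP[t1 t2]; exact: path_length_fin t1 t2 rg.
Qed.

Lemma edist_le_length f a s t : a <= s -> a <= t ->
  path_length f a s \is a fin_num -> path_length f a t \is a fin_num ->
  euclidean_dist (f s) (f t) <=
  `|fine (path_length f a s) - fine (path_length f a t)|.
Proof.
wlog st : s t / s <= t.
  move=> H; have [|/ltW ts] := leP s t; first exact: H.
  by move=> as_ at_ fs ft; rewrite edistC distrC; exact: H.
move=> as_ at_ fs; rewrite (path_lengthD f as_ st) fin_numD => /andP[_ ft].
rewrite fineD// opprD addrA subrr add0r normrN ger0_norm; last first.
  by rewrite fine_ge0// path_length_ge0.
by rewrite -lee_fin fineK// path_length_ge.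
Qed.

(** The two parameters chosen cut off a piece of length `|s - t|, which is at
   least the distance of its ends. *)
Lemma arclength_param_lipschitz g s t : rectifiable g ->
  0 <= s <= fine (curve_length g) -> 0 <= t <= fine (curve_length g) ->
  euclidean_dist (arclength_param g s) (arclength_param g t) <= `|s - t|.
Proof.
move=> rg /(arclength_paramP rg)[s' [s'i -> s'E]] /(arclength_paramP rg)[t' [t'i -> t'E]].
have -> : s = fine (path_length g (curve_lo g) s') by rewrite s'E.
have -> : t = fine (path_length g (curve_lo g) t') by rewrite t'E.
move: s'i t'i; rewrite !in_itv/= => /andP[? _] /andP[? _].
by apply: edist_le_length => //; rewrite ?s'E ?t'E.
Qed.

Lemma fine_curve_length_ge0 g : 0 <= fine (curve_length g).
Proof. by rewrite fine_ge0// path_length_ge0// curve_lo_le_hi. Qed.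

Lemma arclength_param0 g : rectifiable g -> arclength_param g 0 = curve_start g.
Proof.
move=> rg; have [|t [ti -> tE]] := arclength_paramP (s := 0) rg.
  by rewrite lexx fine_curve_length_ge0.
apply: edist_eq0; rewrite edistC.
move: ti; rewrite !in_itv/= => /andP[t0 _].
rewrite (le_trans (edist_le_length (lexx _) t0 _ _))// ?path_lengthxx ?tE//=.
by rewrite subrr normr0.
Qed.

Lemma arclength_param_length g : rectifiable g ->
  arclength_param g (fine (curve_length g)) = curve_end g.
Proof.
move=> rg; have [|t [ti -> tE]] := arclength_paramP (s := fine (curve_length g)) rg.
  by rewrite lexx fine_curve_length_ge0.
have fl : curve_length g \is a fin_num.
  by rewrite ge0_fin_numE// path_length_ge0// curve_lo_le_hi.
apply: edist_eq0; move: ti; rewrite !in_itv/= => /andP[t0 _].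
rewrite (le_trans (edist_le_length t0 (curve_lo_le_hi g) _ _))// ?tE//=.
by rewrite subrr normr0.
Qed.

End arclength.

(** * Changes of variable and Tonelli's theorem *)

Section change_of_variable.
Context {R : realType}.
Notation mu := (@lebesgue_measure R).
Notation T := (measurableTypeR R).
Implicit Types (f : T -> \bar R) (D : set T).

(** A map that preserves the measure of the intervals preserves the Lebesgue
   measure, by uniqueness, hence integrals. *)
Lemma measure_preserving_integral (phi : T -> T) D f :
  measurable_fun [set: T] phi ->
  (forall a b : R, a < b -> mu (phi @^-1` `]a, b]) = (b - a)%:E) ->
  measurable D -> measurable_fun D f -> (forall x, D x -> 0 <= f x)%E ->
  (\int[mu]_(x in phi @^-1` D) f (phi x) = \int[mu]_(x in D) f x)%E.
Proof.
move=> mphi phiE mD mf f0.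
have [nu nuE] : exists nu : {measure set T -> \bar R}, forall A, nu A = mu (phi @^-1` A).
  pose phi' : {mfun T >-> T} := HB.pack phi (isMeasurableFun.Build _ _ _ _ _ mphi).
  by exists (pushforward mu phi').
have munu A : measurable A -> mu A = nu A.
  apply: lebesgue_measure_unique => X /ocitvP[->|[[a b] /= ab ->]].
    by rewrite !measure0.
  by rewrite nuE phiE// lebesgue_measure_itv /= lte_fin ab EFinB.
rewrite (@eq_measure_integral _ _ _ D nu mu f); last by move=> A mA _; exact: munu.
rewrite -(@ge0_integral_pushforward _ _ _ _ _ phi mphi mu D f)//; last first.
  by move=> y /set_mem; exact: f0.
by apply: eq_measure_integral => A mA _; rewrite nuE.
Unshelve. exact: mphi. Qed.

Lemma integral_shift c D f : measurable D -> measurable_fun D f ->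
  (forall x, D x -> 0 <= f x)%E ->
  (\int[mu]_(x in [set x | D (x + c)%R]) f (x + c)%R = \int[mu]_(x in D) f x)%E.
Proof.
move=> mD mf f0.
apply: (@measure_preserving_integral (fun x : T => (x + c)%R : T)) => //.
  exact: measurable_funD.
move=> a b ab; rewrite (_ : _ @^-1` _ = `]a - c, b - c]%classic); last first.
  by apply/seteqP; split=> x /=; rewrite !in_itv/= ltrBlDr lerBrDr.
rewrite lebesgue_measure_itv /= lte_fin ltrD2r ab -EFinB.
by congr EFin; ring.
Qed.

Lemma integral_reflect D f : measurable D -> measurable_fun D f ->
  (forall x, D x -> 0 <= f x)%E ->
  (\int[mu]_(x in [set x | D (- x)%R]) f (- x)%R = \int[mu]_(x in D) f x)%E.
Proof.
move=> mD mf f0.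
apply: (@measure_preserving_integral (fun x : T => (- x)%R : T)) => //.
  exact: oppr_measurable.
move=> a b ab; rewrite (_ : _ @^-1` _ = `[- b, - a[%classic); last first.
  by apply/seteqP; split=> x /=; rewrite !in_itv/= lerNl ltrNr andbC.
rewrite lebesgue_measure_itv /= lte_fin ltrN2 ab -EFinB.
by congr EFin; ring.
Qed.

End change_of_variable.

Lemma measurable_patch d (T : measurableType d) (R : realType) (D : set T)
    (f : T -> \bar R) :
  measurable D -> measurable_fun [set: T] f -> measurable_fun [set: T] (f \_ D).
Proof.
by move=> mD mf; apply: ((measurable_restrictT f mD).1); exact: measurable_funTS mf.
Qed.

Section tonelli.
Context d1 d2 (T1 : measurableType d1) (T2 : measurableType d2) {R : realType}.
Variables (m1 : {sigma_finite_measure set T1 -> \bar R})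
  (m2 : {sigma_finite_measure set T2 -> \bar R}).

Lemma tonelli_on (D1 : set T1) (D2 : set T2) (f : T1 * T2 -> \bar R) :
  measurable D1 -> measurable D2 -> measurable_fun [set: T1 * T2] f ->
  (forall x, 0 <= f x)%E ->
  (\int[m1]_(x in D1) \int[m2]_(y in D2) f (x, y) =
   \int[m2]_(y in D2) \int[m1]_(x in D1) f (x, y))%E.
Proof.
move=> mD1 mD2 mf f0.
have mD : measurable (D1 `*` D2) by exact: measurableX.
pose g := f \_ (D1 `*` D2).
have g0 x : (0 <= g x)%E by rewrite /g patchE; case: ifP.
have mg : measurable_fun [set: T1 * T2] g.
  exact: (measurable_patch mD mf).
have := @fubini_tonelli _ _ _ _ _ m1 m2 g mg g0.
have -> : (\int[m1]_x \int[m2]_y g (x, y))%E =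
    (\int[m1]_(x in D1) \int[m2]_(y in D2) f (x, y))%E.
  rewrite [RHS]integral_mkcond; apply: eq_integral => x _.
  rewrite patchE; case: ifPn => xD1; last first.
    by apply: integral0_eq => y _; rewrite /g patchE in_setX/= (negbTE xD1).
  rewrite [RHS]integral_mkcond; apply: eq_integral => y _.
  by rewrite /g !patchE in_setX/= xD1.
move=> ->.
rewrite [RHS]integral_mkcond; apply: eq_integral => y _.
rewrite patchE; case: ifPn => yD2; last first.
  by apply: integral0_eq => x _; rewrite /g patchE in_setX/= (negbTE yD2) andbF.
rewrite [RHS]integral_mkcond; apply: eq_integral => x _.
by rewrite /g !patchE in_setX/= yD2 andbT.
Qed.

Lemma tonelli_rect (D1 : set T1) (D2 : set T2) (f : T1 * T2 -> \bar R) :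
  measurable D1 -> measurable D2 -> measurable_fun [set: T1 * T2] f ->
  (forall x, 0 <= f x)%E ->
  (\int[m1 \x m2]_(z in D1 `*` D2) f z =
   \int[m1]_(x in D1) \int[m2]_(y in D2) f (x, y))%E.
Proof.
move=> mD1 mD2 mf f0.
have mD : measurable (D1 `*` D2) by exact: measurableX.
pose g := f \_ (D1 `*` D2).
have g0 x : (0 <= g x)%E by rewrite /g patchE; case: ifP.
have mg : measurable_fun [set: T1 * T2] g.
  exact: (measurable_patch mD mf).
rewrite integral_mkcond (@fubini_tonelli1 _ _ _ _ _ m1 m2 g mg g0) [RHS]integral_mkcond.
apply: eq_integral => x _; rewrite /fubini_F patchE.
case: ifPn => xD1; last first.
  by apply: integral0_eq => y _; rewrite /g patchE in_setX/= (negbTE xD1).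
rewrite [RHS]integral_mkcond; apply: eq_integral => y _.
by rewrite /g !patchE in_setX/= xD1.
Qed.

End tonelli.

(** * Curves parametrized by arc length *)

Section unit_speed_curves.
Context {R : realType}.
Notation mu := (@lebesgue_measure R).
Notation T := (measurableTypeR R).
Implicit Types (x y z e : R * R) (f : R -> R * R) (a b c l d s t : R).
Implicit Type rho : R * R -> \bar R.

Definition short_map f l :=
  forall s t, s \in `[0, l] -> t \in `[0, l] -> euclidean_dist (f s) (f t) <= `|s - t|.

(** Composing with the retraction onto [0, l] gives functions that are
   continuous on the whole line; this reduces continuity and measurability on
   an interval to the global notions. *)
Lemma short_map_extension f l : 0 <= l -> short_map f l ->
  exists g1 g2 : R -> R, [/\ continuous g1, continuous g2 &
    {in `[0, l], f =1 fun t => (g1 t, g2 t)}].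
Proof.
move=> l0 fl.
pose k t := Num.max 0 (Num.min t l).
have kin t : k t \in `[0, l] by rewrite in_itv/= le_max lexx/= ge_max l0 ge_min lexx orbT.
have kk s t : `|k s - k t| <= `|s - t|.
  rewrite /k /Num.max /Num.min.
  by do !case: ifPn; rewrite -?leNgt => *; rewrite ler_norml; apply/andP; split;
    have := ler_norm (s - t); have := ler_norm (t - s); rewrite distrC; lra.
have C (pr : R * R -> R) :
    (forall x y, `|pr x - pr y| <= euclidean_dist x y) -> continuous (pr \o f \o k).
  move=> prd x; apply/cvgrPdist_lt => e e0; exists e => //= y xy.
  rewrite (le_lt_trans (prd _ _))// (le_lt_trans (fl _ _ _ _))//.
  exact: le_lt_trans (kk _ _) xy.
exists (fst \o f \o k), (snd \o f \o k); split.
- exact: C edist_fst.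
- exact: C edist_snd.
- move=> t; rewrite in_itv/= => /andP[t0 tl] /=.
  by rewrite /k (min_idPl tl) (max_idPr t0); case: (f t).
Qed.

Lemma short_map_continuous f l : 0 <= l -> short_map f l ->
  {within `[0, l], continuous f}.
Proof.
move=> l0 /(short_map_extension l0)[g1 [g2 [c1 c2 fg]]].
apply: (@subspace_eq_continuous _ _ _ (fun t => (g1 t, g2 t))).
  by move=> t /set_mem /= tl; rewrite /from_subspace fg.
by apply: continuous_subspaceT => x; exact: (cvg_pair (c1 x) (c2 x)).
Qed.

Lemma short_map_measurable rho f l : 0 <= l -> short_map f l ->
  measurable_fun [set: T * T] rho ->
  measurable_fun (`[0, l] : set T) (rho \o f).
Proof.
move=> l0 /(short_map_extension l0)[g1 [g2 [c1 c2 fg]]] mrho.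
apply: (@eq_measurable_fun _ _ _ _ _ (fun t => rho (g1 t, g2 t))).
  by move=> t /set_mem /= tl; rewrite fg.
apply: measurable_funTS; apply: (measurableT_comp mrho).
by apply: measurable_fun_pair; apply: continuous_measurable_fun.
Qed.

(** Curves parametrized by arc length: their line integrals are plain
   integrals, and they are prolonged by segments without reparametrization. *)
Definition unit_speed f l :=
  0 <= l /\ forall t, t \in `[0, l] -> path_length f 0 t = t%:E.

Lemma unit_speed_short f l : unit_speed f l -> short_map f l.
Proof.
move=> [l0 fE] s t sl tl.
have := sl; have := tl; rewrite !in_itv/= => /andP[t0 _] /andP[s0 _].
by have := @edist_le_length _ f 0 s t s0 t0; rewrite !fE//=; apply.
Qed.

Definition unit_speed_curve f l (fl : unit_speed f l) : curve R :=
  @Curve R 0 l f fl.1 (short_map_continuous fl.1 (unit_speed_short fl)).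

Lemma unit_speed_length f l (fl : unit_speed f l) :
  curve_length (unit_speed_curve fl) = l%:E.
Proof. by rewrite /curve_length /= fl.2// in_itv/= lexx fl.1. Qed.

Lemma unit_speed_line_integral rho f l (fl : unit_speed f l) :
  line_integral rho (unit_speed_curve fl) =
  (\int[mu]_(t in `[0%R, l]) rho (f t))%E.
Proof.
rewrite /line_integral unit_speed_length /=.
apply: eq_integral => s /set_mem /= sl; congr rho.
set A := mkset _; have [tl tE] : A (xget 0 A).
  by apply: (xgetPex 0); exists s; split=> //; exact: fl.2.
by move: tE; rewrite fl.2// => -[->].
Qed.

Definition ray z e t : R * R := (z.1 + t * e.1, z.2 + t * e.2).

Lemma ray0 z e : ray z e 0 = z.
Proof. by rewrite /ray !mul0r !addr0; case: z. Qed.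

Lemma path_length_geodesic f a b : a <= b ->
  (forall s t, a <= s -> s <= t -> t <= b -> euclidean_dist (f s) (f t) = t - s) ->
  path_length f a b = (b - a)%:E.
Proof.
move=> ab fd.
have H (s : seq R) c : a <= c -> itv_partition c b s -> chain_length f c s = b - c.
  elim: s c => [|x s IH] c ac /=; first by move=> /itv_partition_nil ->; rewrite subrr.
  move=> /[dup] [[/= /andP[cx _] _]] /itv_partition_cons xs.
  have xb := itv_partition_le xs.
  by rewrite IH ?fd ?(ltW cx)// ?(le_trans ac (ltW cx))//; ring.
apply/eqP; rewrite eq_le; apply/andP; split.
  by apply: path_length_lub => s /H ->.
by rewrite -(fd a b)// path_length_ge.
Qed.

Definition extend f l e t := if t <= l then f t else ray (f l) e (t - l).

Lemma extend_unit_speed f l e d : unit_speed f l -> 0 <= d ->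
  e.1 ^+ 2 + e.2 ^+ 2 = 1 -> unit_speed (extend f l e) (l + d).
Proof.
move=> fl d0 e1; split=> [|t]; first by rewrite addr_ge0// fl.1.
rewrite in_itv/= => /andP[t0 tld].
have ext0 s : 0 <= s -> s <= l -> path_length (extend f l e) 0 s = s%:E.
  move=> s0 sl; rewrite (@eq_path_length _ _ f)// ?fl.2 ?in_itv/= ?s0//.
  move=> u; rewrite in_itv/= => /andP[_ us].
  by rewrite /extend (le_trans us sl).
have [tl|lt] := leP t l; first exact: ext0.
rewrite (path_lengthD _ fl.1 (ltW lt)) ext0 ?fl.1//.
rewrite (@path_length_geodesic _ l t) ?ltW// -?EFinD; first by congr EFin; ring.
move=> s u ls su ut.
have extE v : l <= v -> extend f l e v = ray (f l) e (v - l).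
  rewrite le_eqVlt /extend => /predU1P[<-|lv]; first by rewrite lexx subrr ray0.
  by rewrite leNgt lv.
rewrite !extE// ?(le_trans ls)// /euclidean_dist /ray /=.
rewrite (_ : _ + _ = (u - s) ^+ 2).
  by rewrite sqrtr_sqr ger0_norm// subr_ge0.
by rewrite -[RHS]mulr1 -e1; ring.
Qed.

Lemma integral_extend rho f l e d : unit_speed f l -> 0 <= d ->
  e.1 ^+ 2 + e.2 ^+ 2 = 1 -> measurable_fun [set: T * T] rho ->
  (forall x, 0 <= rho x)%E ->
  (\int[mu]_(t in `[0%R, (l + d)%R]) rho (extend f l e t) =
   \int[mu]_(t in `[0%R, l]) rho (f t) + \int[mu]_(t in `[0%R, d]) rho (ray (f l) e t))%E.
Proof.
move=> fl d0 e1 mrho rho0.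
have eu := extend_unit_speed fl d0 e1.
have mext := short_map_measurable eu.1 (unit_speed_short eu) mrho.
have E : `[0, l + d]%classic = `[0, l] `|` `]l, l + d] :> set R.
  by apply: itv_bndbnd_setU; rewrite bnd_simp ?fl.1// lerDl.
rewrite {1}E ge0_integral_setU//=; last 2 first.
  by rewrite -E.
  apply/disj_set2P/seteqP; split => // x /=; rewrite !in_itv/= => -[/andP[_ xl] /andP[lx _]].
  by rewrite ltNge xl in lx.
congr (_ + _)%E.
  by apply: eq_integral => t /set_mem /=; rewrite in_itv/= /extend => /andP[_ ->].
have mray : measurable_fun [set: T] (fun t => rho (ray (f l) e t)).
  apply: (measurableT_comp mrho); apply: measurable_fun_pair;
    apply: measurable_funD => //; exact: mulrr_measurable.
have mrayl : measurable_fun [set: T] (fun t => rho (ray (f l) e (t - l))).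
  by apply: (measurableT_comp mray); apply: measurable_funB.
under eq_integral => t /set_mem /=.
  rewrite in_itv/= => /andP[lt _]; rewrite /extend leNgt lt /=; over.
rewrite -(@integral_shift _ l _ (fun t => rho (ray (f l) e (t - l))))//; last first.
  exact: measurable_funTS.
rewrite -(integral_itv_obnd_cbnd (r := 0)); last exact: measurable_funTS.
under eq_integral do rewrite addrK.
congr (integral _ _ _).
by apply/seteqP; split=> x /=; rewrite !in_itv/= ltrDr addrC lerD2l.
Qed.

End unit_speed_curves.

(** * The potential of a density *)

Section potential.
Context {R : realType}.
Notation mu := (@lebesgue_measure R).
Notation T := (measurableTypeR R).
Variables (E F : set (R * R)) (rho : R * R -> \bar R).
Hypothesis mrho : measurable_fun [set: T * T] rho.
Hypothesis rho0 : forall x, (0 <= rho x)%E.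
Implicit Types (z e : R * R).

(** The infimum of the line integrals of rho over the curves from F to z that
   avoid E. The competitors avoid E at their ends too, so that they can be
   prolonged; the value 1 truncates the potential, which is therefore finite
   even where no curve arrives. *)
Definition cost_to z : set \bar R := [set c | c = 1%E \/
  exists f l, [/\ unit_speed f l, F (f 0), f l = z,
    forall t, t \in `[0, l] -> ~ E (f t) &
    c = (\int[mu]_(t in `[0%R, l]) rho (f t))%E]].

Definition potential z : R := fine (ereal_inf (cost_to z)).

Lemma potential_bounds z :
  [/\ 0 <= potential z, potential z <= 1 &
      (potential z)%:E = ereal_inf (cost_to z)].
Proof.
have i0 : (0 <= ereal_inf (cost_to z))%E.
  apply: le_ereal_inf_tmp => c [->|[f [l [_ _ _ _ ->]]]]; first exact: lee01.
  exact: integral_ge0.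
have i1 : (ereal_inf (cost_to z) <= 1)%E by apply: ereal_inf_lbound; left.
have fin : ereal_inf (cost_to z) \is a fin_num.
  by rewrite ge0_fin_numE// (le_lt_trans i1)// ltry.
by split; rewrite /potential ?fineK// -lee_fin fineK.
Qed.

(** Every competitor for z, prolonged by the segment, competes for its end. *)
Lemma potential_ray z e d : 0 <= d -> e.1 ^+ 2 + e.2 ^+ 2 = 1 ->
  (forall t, t \in `[0, d] -> ~ E (ray z e t)) ->
  ((potential (ray z e d))%:E <=
   (potential z)%:E + \int[mu]_(t in `[0%R, d]) rho (ray z e t))%E.
Proof.
move=> d0 e1 nE.
have [_ u1 _] := potential_bounds (ray z e d).
have [u0 _ uE] := potential_bounds z.
set I := (\int[mu]_(t in _) _)%E.
have I0 : (0 <= I)%E by exact: integral_ge0.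
have [->|] := eqVneq I +oo%E; first by rewrite addey// leey.
rewrite -ltey -ge0_fin_numE// => Ifin.
rewrite -leeBlDr// uE; apply: le_ereal_inf_tmp => c [->|].
  by rewrite leeBlDr// (@le_trans _ _ 1%E) ?lee_fin// leeDl.
move=> [f [l [fl F0 fz fE ->]]]; rewrite leeBlDr// /I.
have [_ _ ->] := potential_bounds (ray z e d).
apply: ereal_inf_lbound; right; exists (extend f l e), (l + d).
split.
- exact: extend_unit_speed.
- by rewrite /extend fl.1.
- rewrite /extend; case: ifPn => [|_]; last by rewrite addrAC subrr add0r fz.
  by rewrite gerDl => d_le0; have -> : d = 0 by [lra]; rewrite addr0 ray0.
- move=> t; rewrite in_itv/= => /andP[t0 tld]; rewrite /extend.
  case: ifPn => [tl|]; first by apply: fE; rewrite in_itv/= t0.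
  by rewrite -ltNge => lt; rewrite fz; apply: nE; rewrite in_itv/= subr_ge0 ltW//= lerBlDl.
- by rewrite integral_extend// fz.
Qed.

Lemma constant_unit_speed z : unit_speed (fun=> z) 0.
Proof.
split=> // t; rewrite in_itv/= => t0.
have -> : t = 0 by apply/eqP; rewrite eq_le andbC.
exact: path_lengthxx.
Qed.

Lemma potential_source z : F z -> ~ E z -> potential z = 0.
Proof.
move=> Fz nEz; have [u0 _ uE] := potential_bounds z.
apply/eqP; rewrite eq_le u0 andbT -lee_fin uE.
apply: ereal_inf_lbound; right; exists (fun=> z), 0; split => //.
- exact: constant_unit_speed.
- by rewrite set_itv1 integral_set1.
Qed.

Lemma potential_target (F' : set (R * R)) z :
  admissible (joining F F' `&` avoiding E) rho -> F' z -> potential z = 1.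
Proof.
move=> [_ _ adm] F'z; have [_ u1 uE] := potential_bounds z.
apply/eqP; rewrite eq_le u1 -lee_fin uE.
apply: le_ereal_inf_tmp => c [->//|[f [l [fl F0 fz fE ->]]]].
rewrite -unit_speed_line_integral; apply: adm; last first.
  by rewrite /rectifiable unit_speed_length ltry.
split; first by rewrite /joining /curve_start /curve_end /= fz.
apply/seteqP; split=> // x [[[t tl <-] _]]; exact: fE.
Qed.

End potential.

(** * Integral inequalities *)

Section general_integrals.
Context d (T : measurableType d) (R : realType) (m : {measure set T -> \bar R}).
Implicit Types (D : set T) (f : T -> \bar R).

Lemma mul_le_sqrD (t : R) (x : \bar R) : 0 <= t -> (0 <= x)%E ->
  ((2 * t)%:E * x <= (t ^+ 2)%:E + x ^+ 2)%E.
Proof.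
move=> t0; case: x => [r| |] x0; [|by rewrite expe2 mulyy addey// leey|by []].
rewrite lee_fin in x0; rewrite -EFin_expe -EFinM -EFinD lee_fin.
by have := sqr_ge0 (t - r); nra.
Qed.

Lemma measurable_sqre D f : measurable_fun D f ->
  measurable_fun D (fun x => (f x ^+ 2)%E).
Proof.
move=> mf; apply: (@eq_measurable_fun _ _ _ _ _ (fun x => f x * f x)%E).
  by move=> x _; rewrite expe2.
exact: emeasurable_funM.
Qed.

(** The Cauchy-Schwarz inequality against the constant 1: integrate
   2 t f <= t ^ 2 + f ^ 2 and take for t the mean of f. *)
Lemma sqr_integral_le D f (k : R) : measurable D -> measurable_fun D f ->
  (forall x, D x -> 0 <= f x)%E -> 0 < k -> m D = k%:E ->
  ((\int[m]_(x in D) f x) ^+ 2 <= k%:E * \int[m]_(x in D) (f x ^+ 2))%E.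
Proof.
move=> mD mf f0 k0 mk.
have mf2 := measurable_sqre mf.
set L := (\int[m]_(x in D) f x)%E; set S := (\int[m]_(x in D) (f x ^+ 2))%E.
have L0 : (0 <= L)%E by exact: integral_ge0.
have S0 : (0 <= S)%E by apply: integral_ge0 => x Dx; exact: sqre_ge0.
have key (t : R) : 0 <= t -> ((2 * t)%:E * L <= (t ^+ 2 * k)%:E + S)%E.
  move=> t0; rewrite /L -ge0_integralZl_EFin ?mulr_ge0//.
  rewrite (EFinM (t ^+ 2)) -mk -integral_cst// /S -ge0_integralD//; last 2 first.
  - by move=> x _; rewrite lee_fin sqr_ge0.
  - by move=> x _; exact: sqre_ge0.
  apply: ge0_le_integral => //.
  - by move=> x Dx; rewrite mule_ge0 ?f0// lee_fin mulr_ge0.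
  - exact: measurable_funeM.
  - exact: emeasurable_funD.
  - by move=> x Dx; apply: mul_le_sqrD => //; exact: f0.
have [->|] := eqVneq S +oo%E; first by rewrite gt0_muley ?lte_fin// leey.
rewrite -ltey -ge0_fin_numE// => Sfin.
have Lfin : L \is a fin_num.
  rewrite ge0_fin_numE//; apply: (@le_lt_trans _ _ ((2 * 1)%:E * L)%E).
    by rewrite lee_pemull// lee_fin mulr1 ler1n.
  apply: le_lt_trans (key 1 ler01) _.
  by rewrite -(fineK Sfin) -EFinD ltry.
move: key L0 S0; rewrite -(fineK Sfin) -(fineK Lfin).
move: (fine L) (fine S) => l s key; rewrite !lee_fin => l0 s0.
have := key (l / k) (divr_ge0 l0 (ltW k0)).
rewrite -!EFinM -EFinD !lee_fin => H.
have kk : k * k^-1 = 1 by rewrite divff// gt_eqF.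
have : k * (2 * (l / k) * l) <= k * ((l / k) ^+ 2 * k + s) by rewrite ler_pM2l.
have -> : k * (2 * (l / k) * l) = 2 * l ^+ 2 * (k * k^-1) by ring.
have -> : k * ((l / k) ^+ 2 * k + s) = l ^+ 2 * (k * k^-1) ^+ 2 + k * s by ring.
by rewrite kk; nra.
Qed.

(** Monotone convergence on the complements; since only the integral of f is
   assumed to be finite, the sets D n may have infinite measure. *)
Lemma integral_cvg0_shrinking (D : nat -> set T) f :
  (forall n, measurable (D n)) -> (forall n k, (n <= k)%N -> D k `<=` D n) ->
  m (\bigcap_n D n) = 0%E -> measurable_fun [set: T] f ->
  (forall x, 0 <= f x)%E -> (\int[m]_x f x < +oo)%E ->
  forall e : R, 0 < e -> exists n, (\int[m]_(x in D n) f x <= e%:E)%E.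
Proof.
move=> mD Dle D0 mf f0 If e e0.
have nd : {homo (fun n => ~` D n) : n k / (n <= k)%N >-> (n <= k)%O}.
  by move=> n k nk; apply/subsetPset/subsetC/Dle.
have cv : ((\int[m]_(x in ~` D n) f x)%E @[n --> \oo] -->
   (\int[m]_(x in \bigcup_n ~` D n) f x)%E).
  apply: ge0_nondecreasing_set_cvg_integral => //.
  - by move=> i; exact: measurableC.
  - by move=> i; exact: measurable_funTS.
have E (A : set T) : measurable A ->
    (\int[m]_x f x = \int[m]_(x in A) f x + \int[m]_(x in ~` A) f x)%E.
  move=> mA; rewrite -(setUv A) ge0_integral_setU//.
  - exact: measurableC.
  - by rewrite setUv.
  - by apply/disj_set2P; rewrite setICr.
have mcap : measurable (\bigcap_n D n) by exact: bigcap_measurable.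
have I0 : (\int[m]_(x in \bigcup_n ~` D n) f x = \int[m]_x f x)%E.
  rewrite -setC_bigcap (E _ mcap).
  by rewrite (null_set_integral mcap)// ?add0e//; exact: measurable_funTS.
rewrite I0 in cv.
have Ige0 : (0 <= \int[m]_x f x)%E by exact: integral_ge0.
have Ifin : (\int[m]_x f x)%E \is a fin_num by rewrite ge0_fin_numE.
move: cv; rewrite -(fineK Ifin); move/fine_cvgP => [cfin]; move/cvgrPdist_le => /(_ e e0).
move=> /(filterI cfin)[n _ /(_ n (leqnn n))] /= [Cfin ce].
exists n; move: Ifin ce; rewrite (E _ (mD n)) fin_numD => /andP[Dfin _].
rewrite fineD// addrK => ce.
by rewrite -(fineK Dfin) lee_fin (le_trans (ler_norm _)).
Qed.

Lemma integral_absolutely_continuous f : measurable_fun [set: T] f ->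
  (forall x, 0 <= f x)%E -> (\int[m]_x f x < +oo)%E ->
  forall e : R, 0 < e -> exists2 del : R, 0 < del &
    forall A, measurable A -> (m A < del%:E)%E -> (\int[m]_(x in A) f x <= e%:E)%E.
Proof.
move=> mf f0 If e e0.
have intf : m.-integrable [set: T] f.
  by apply/integrableP; split=> //; under eq_integral do rewrite gee0_abs//.
have aef : ae_eq m [set: T] f (EFin \o (fine \o f)).
  have := integrable_ae measurableT intf; apply: filterS => x fin _ /=.
  by rewrite fineK// fin.
have mff : measurable_fun [set: T] (EFin \o (fine \o f)).
  by apply/measurable_EFinP; apply: measurableT_comp.
have intff : m.-integrable [set: T] (EFin \o (fine \o f)).
  apply: le_integrable intf => // x _ /=.
  by case: (f x) (f0 x) => [r| |] //= _; rewrite normr0 leey.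
have [del [d0 H]] := integral_normr_continuous intff e0.
exists del => // A mA /(H A mA)/ltW; rewrite -lee_fin.
apply: le_trans.
rewrite (@ae_eq_integral _ _ _ _ _ (EFin \o (fine \o f)))//; last 3 first.
- exact: measurable_funTS.
- exact: measurable_funTS.
- by apply: filterS aef => x h _; exact: h.
have intffA : m.-integrable A (EFin \o (fine \o f)).
  exact: integrableS intff.
rewrite /Rintegral fineK.
  rewrite le_eqVlt; apply/orP; left; apply/eqP; apply: eq_integral => x _ /=.
  by rewrite ger0_norm ?fine_ge0.
by have /integrable_norm := intffA; move/integrable_fin_num; apply.
Qed.

End general_integrals.

(** * Averages over squares *)

Lemma measurable_integral_on (R : realType) d1 d2 (T1 : measurableType d1)
    (T2 : measurableType d2)
    (m : {sigma_finite_measure set T2 -> \bar R})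
    (D : set T2) (f : T1 * T2 -> \bar R) :
  measurable D -> measurable_fun [set: T1 * T2] f -> (forall x, 0 <= f x)%E ->
  measurable_fun [set: T1] (fun x => \int[m]_(y in D) f (x, y))%E.
Proof.
move=> mD mf f0.
have mX : measurable ([set: T1] `*` D) by exact: measurableX.
pose g := f \_ ([set: T1] `*` D).
have g0 x : (0 <= g x)%E by rewrite /g patchE; case: ifP.
have mg : measurable_fun [set: T1 * T2] g := measurable_patch mX mf.
have := @measurable_fun_fubini_tonelli_F _ _ _ _ _ m g mg g0.
apply: eq_measurable_fun => x _; rewrite /fubini_F [RHS]integral_mkcond.
by apply: eq_integral => y _; rewrite /g !patchE in_setX in_setT.
Qed.

Section planar.
Context {R : realType}.
Notation mu := (@lebesgue_measure R).
Notation T := (measurableTypeR R).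
Implicit Types (p v z h : R * R) (r : R) (f : R * R -> \bar R).

Lemma measurable_translation v :
  measurable_fun [set: T * T] (fun z => (v + z : T * T)).
Proof.
have m1 : measurable_fun [set: T * T] (fun z : T * T => (v.1 + z.1 : R)).
  by apply: measurable_funD => //; exact: measurable_fst.
have m2 : measurable_fun [set: T * T] (fun z : T * T => (v.2 + z.2 : R)).
  by apply: measurable_funD => //; exact: measurable_snd.
exact: (measurable_fun_pair m1 m2).
Qed.

Lemma measurable_addp :
  measurable_fun [set: (T * T) * (T * T)] (fun x => (x.1 + x.2 : T * T)).
Proof.
have F1 : measurable_fun [set: (T * T) * (T * T)] (fun x => (x.1.1 + x.2.1 : R)).
  apply: measurable_funD.
    by apply: (measurableT_comp measurable_fst); exact: measurable_fst.
  by apply: (measurableT_comp measurable_fst); exact: measurable_snd.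
have F2 : measurable_fun [set: (T * T) * (T * T)] (fun x => (x.1.2 + x.2.2 : R)).
  apply: measurable_funD.
    by apply: (measurableT_comp measurable_snd); exact: measurable_fst.
  by apply: (measurableT_comp measurable_snd); exact: measurable_snd.
exact: (measurable_fun_pair F1 F2).
Qed.

Lemma integral_translation v f : measurable_fun [set: T * T] f ->
  (forall z, 0 <= f z)%E ->
  (\int[m2 R]_z f (v + z)%R = \int[m2 R]_z f z)%E.
Proof.
move=> mf f0.
have mfv := measurableT_comp mf (measurable_translation v).
have := @fubini_tonelli1 _ _ _ _ _ mu mu _ mfv (fun=> f0 _).
rewrite /= => ->; have := @fubini_tonelli1 _ _ _ _ _ mu mu _ mf f0.
rewrite /= => ->; rewrite /fubini_F /=.
pose G (x : T) := (\int[mu]_y f (x, y))%E.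
have mG : measurable_fun [set: T] G.
  exact: (@measurable_integral_on _ _ _ T T mu setT f).
have G0 x : (0 <= G x)%E by exact: integral_ge0.
have := @integral_shift R v.1 setT G measurableT mG (fun x _ => G0 x).
rewrite (_ : [set x | _] = setT); last exact/seteqP.
move=> <-; apply: eq_integral => x _; rewrite /G.
have mfx : measurable_fun [set: T] (fun y => f (x + v.1, y)).
  by apply: (measurableT_comp mf); exact: pair1_measurable.
have := @integral_shift R v.2 setT _ measurableT mfx (fun y _ => f0 _).
rewrite (_ : [set x | _] = setT); last exact/seteqP.
by move=> <-; apply: eq_integral => y _; congr f; congr pair; rewrite addrC.
Qed.

Definition square p r : set (R * R) :=
  `[p.1 - r, p.1 + r]%classic `*` `[p.2 - r, p.2 + r]%classic.

Lemma sqP p r z : square p r z <-> `|z.1 - p.1| <= r /\ `|z.2 - p.2| <= r.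
Proof.
rewrite /square /= !in_itv/= !ler_norml.
split=> -[/andP[? ?] /andP[? ?]]; split; apply/andP; split; lra.
Qed.

Lemma measurable_sq p r : measurable (square p r : set (T * T)).
Proof. by apply: measurableX. Qed.

Lemma m2_sq p r : 0 <= r -> m2 R (square p r) = ((2 * r) ^+ 2)%:E.
Proof.
move=> r0; rewrite product_measure1E//= !lebesgue_measure_itv/= !lte_fin.
have [->|rn0] := eqVneq r 0; first by rewrite !subr0 !addr0 !ltxx mul0e mulr0 expr0n.
have rp : 0 < r by rewrite lt_neqAle eq_sym rn0.
rewrite !ltrD2l gtrN// -!EFinB -EFinM; congr EFin; ring.
Qed.

Lemma sq_sub p q r r' : `|p.1 - q.1| <= r' - r -> `|p.2 - q.2| <= r' - r ->
  square p r `<=` square q r'.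
Proof.
move=> h1 h2 z /sqP[z1 z2]; apply/sqP; split.
  have -> : z.1 - q.1 = (z.1 - p.1) + (p.1 - q.1) by ring.
  by rewrite (le_trans (ler_normD _ _))//; lra.
have -> : z.2 - q.2 = (z.2 - p.2) + (p.2 - q.2) by ring.
by rewrite (le_trans (ler_normD _ _))//; lra.
Qed.

Lemma integral_sq p r f : measurable_fun [set: T * T] f ->
  (forall z, 0 <= f z)%E ->
  (\int[m2 R]_(h in square 0%R r) f (p + h)%R = \int[m2 R]_(z in square p r) f z)%E.
Proof.
move=> mf f0; have mS := measurable_sq p r.
rewrite [RHS]integral_mkcond -(@integral_translation p); last 2 first.
- exact: measurable_patch.
- by move=> z; rewrite patchE; case: ifP.
rewrite [LHS]integral_mkcond; apply: eq_integral => h _; rewrite !patchE.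
suff -> : (h \in square 0 r) = ((p + h)%R \in square p r) by [].
by apply/idP/idP => /set_mem/sqP[] /= h1 h2; apply/mem_set/sqP; split;
  move: h1 h2; rewrite /= !subr0 ![_ + _ + - _]addrAC !subrr !add0r.
Qed.

Lemma integral_sq_le p q r r' f : measurable_fun [set: T * T] f ->
  (forall z, 0 <= f z)%E -> square p r `<=` square q r' ->
  (\int[m2 R]_(z in square p r) f z <= \int[m2 R]_(z in square q r') f z)%E.
Proof.
move=> mf f0 pq; apply: ge0_subset_integral => //; try exact: measurable_sq.
exact: measurable_funTS.
Qed.

Lemma m2_sigma_finite : sigma_finite [set: T * T] (m2 R).
Proof.
exists (fun n => square 0 n%:R); last first.
  by move=> n; split; [exact: measurable_sq|rewrite m2_sq// ltry].
apply/seteqP; split=> // z _; exists (Num.truncn (`|z.1| + `|z.2|)).+1 => //.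
have /ltW h := truncnS_gt (`|z.1| + `|z.2|).
by apply/sqP; rewrite /= !subr0; split; apply: le_trans h; rewrite ?lerDl ?lerDr.
Qed.
(** Lebesgue measure of the plane as a sigma-finite measure, the form that
   Tonelli's theorem asks for; it is convertible to the product measure. *)
Definition area : {sigma_finite_measure set (T * T)%type -> \bar R} :=
  HB.pack (m2 R) (Measure_isSigmaFinite.Build _ _ _ (m2 R) m2_sigma_finite).

Definition sq_mass f r z := (\int[m2 R]_(w in square z r) f w)%E.

Lemma sq_mass_ge0 f r z : (forall z, 0 <= f z)%E -> (0 <= sq_mass f r z)%E.
Proof. by move=> f0; exact: integral_ge0. Qed.

Lemma measurable_sq_mass f r : measurable_fun [set: T * T] f ->
  (forall z, 0 <= f z)%E -> measurable_fun [set: T * T] (sq_mass f r).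
Proof.
move=> mf f0.
apply: (@eq_measurable_fun _ _ _ _ _ (fun z => \int[m2 R]_(h in square 0%R r) f (z + h)%R)%E).
  by move=> z _; rewrite integral_sq.
apply: (@measurable_integral_on _ _ _ (T * T)%type (T * T)%type area (square 0 r)
  (fun x => f (x.1 + x.2)%R)) => //.
- exact: measurable_sq.
- exact: (measurableT_comp mf measurable_addp).
Qed.

(** Averaging over squares does not increase the L2 norm: Cauchy-Schwarz on
   each square, then Tonelli and translation invariance. *)
Lemma sqr_sq_mass_integral f r : 0 < r -> measurable_fun [set: T * T] f ->
  (forall z, 0 <= f z)%E ->
  (\int[m2 R]_z (sq_mass f r z ^+ 2) <=
   (((2 * r) ^+ 2) ^+ 2)%:E * \int[m2 R]_z (f z ^+ 2))%E.
Proof.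
move=> r0 mf f0.
have mf2 : measurable_fun [set: T * T] (fun z => f z ^+ 2)%E by exact: measurable_sqre.
have f20 z : (0 <= f z ^+ 2)%E by exact: sqre_ge0.
have k0 : 0 < (2 * r) ^+ 2 by rewrite exprn_gt0// mulr_gt0.
apply: (@le_trans _ _ (\int[m2 R]_z (((2 * r) ^+ 2)%:E * sq_mass (fun z => f z ^+ 2) r z))%E).
  apply: ge0_le_integral => //.
  - by move=> z _; exact: sqre_ge0.
  - by apply: measurable_sqre; exact: measurable_sq_mass.
  - by apply: measurable_funeM; exact: measurable_sq_mass.
  - move=> z _; apply: sqr_integral_le => //.
    + exact: measurable_sq.
    + exact: measurable_funTS.
    + exact: (m2_sq z (ltW r0)).
rewrite ge0_integralZl_EFin//; last 3 first.
- by move=> z _; exact: sq_mass_ge0.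
- exact: measurable_sq_mass.
- exact: ltW.
rewrite [((_ ^+ 2) ^+ 2)%:E]EFinM -muleA; apply: lee_wpmul2l.
  by rewrite lee_fin ltW.
have E z : sq_mass (fun z => f z ^+ 2)%E r z =
    (\int[m2 R]_(h in square 0%R r) f (z + h)%R ^+ 2)%E.
  by rewrite /sq_mass -integral_sq.
under eq_integral do rewrite E.
have -> : (\int[m2 R]_z \int[m2 R]_(h in square 0%R r) f (z + h)%R ^+ 2 =
          \int[m2 R]_(h in square 0%R r) \int[m2 R]_z f z ^+ 2)%E.
  etransitivity.
    apply: (@tonelli_on _ _ (T * T)%type (T * T)%type R area area setT (square 0 r)
      (fun x => f (x.1 + x.2)%R ^+ 2)%E) => //.
    - exact: measurable_sq.
    - exact: (measurableT_comp mf2 measurable_addp).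
  apply: eq_integral => h _.
  rewrite -(@integral_translation h (fun z => f z ^+ 2)%E)//.
  by apply: eq_integral => z _; rewrite addrC.
rewrite integral_cst; last exact: measurable_sq.
by rewrite muleC le_eqVlt; apply/orP; left; apply/eqP; congr (_ * _)%E; exact: (m2_sq 0 (ltW r0)).
Qed.

End planar.

(** * Upper gradients along segments *)

Section line_bounds.
Context {R : realType}.
Notation mu := (@lebesgue_measure R).
Notation T := (measurableTypeR R).
Implicit Types (z e : R * R) (a b r : R) (E : set (R * R)).
Implicit Types (rho : R * R -> \bar R) (u : R * R -> R).

(** The function rho is an upper gradient of u along the segments that miss E. *)
Definition line_bounded E rho u := forall z e a b, e.1 ^+ 2 + e.2 ^+ 2 = 1 ->
  a <= b -> (forall t, t \in `[a, b] -> ~ E (ray z e t)) ->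
  (`|u (ray z e b) - u (ray z e a)|%:E <=
   \int[mu]_(t in `[a, b]) rho (ray z e t))%E.

Lemma integral_reverse (f : T -> \bar R) a b : measurable_fun [set: T] f ->
  (forall x, 0 <= f x)%E ->
  (\int[mu]_(t in `[0%R, (b - a)%R]) f (b - t)%R = \int[mu]_(t in `[a, b]) f t)%E.
Proof.
move=> mf f0.
have mfb : measurable_fun [set: T] (fun t => f (t + b)%R).
  by apply: (measurableT_comp mf); exact: measurable_funD.
rewrite -(@integral_shift _ b `[a, b] f)//; last exact: measurable_funTS.
rewrite -(@integral_reflect _ [set x | `[a, b]%classic (x + b)] (fun t => f (t + b)%R))//.
- under [LHS]eq_integral do rewrite addrC.
  congr (integral _ _ _); apply/seteqP; split=> x /=; rewrite !in_itv/= => /andP[? ?];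
  apply/andP; split; lra.
- rewrite (_ : mkset _ = `[a - b, 0]%classic); first exact: measurable_itv.
  by apply/seteqP; split=> x /=; rewrite !in_itv/= => /andP[? ?]; apply/andP; split; lra.
- exact: measurable_funTS.
Qed.

Lemma integral_move (f : T -> \bar R) a b : measurable_fun [set: T] f ->
  (forall x, 0 <= f x)%E ->
  (\int[mu]_(t in `[0%R, (b - a)%R]) f (a + t)%R = \int[mu]_(t in `[a, b]) f t)%E.
Proof.
move=> mf f0.
rewrite -(@integral_shift _ a `[a, b] f)//; last exact: measurable_funTS.
under [LHS]eq_integral do rewrite addrC.
congr (integral _ _ _); apply/seteqP; split=> x /=; rewrite !in_itv/= => /andP[? ?];
apply/andP; split; lra.
Qed.

Lemma ray_ray z e a t : ray (ray z e a) e t = ray z e (a + t).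
Proof. by rewrite /ray /=; congr pair; ring. Qed.

Lemma ray_opp z e a t : ray (ray z e a) (- e.1, - e.2) t = ray z e (a - t).
Proof. by rewrite /ray /=; congr pair; ring. Qed.

Lemma measurable_ray rho z e : measurable_fun [set: T * T] rho ->
  measurable_fun [set: T] (fun t => rho (ray z e t)).
Proof.
move=> mrho; apply: (measurableT_comp mrho); apply: measurable_fun_pair;
  apply: measurable_funD => //; exact: mulrr_measurable.
Qed.

(** Prolong by the segment in both directions. *)
Lemma potential_line_bounded E F rho : measurable_fun [set: T * T] rho ->
  (forall x, 0 <= rho x)%E -> line_bounded E rho (potential E F rho).
Proof.
move=> mrho rho0 z e a b e1 ab nE.
have mray := measurable_ray z e mrho.
have fwd : ((potential E F rho (ray z e b))%:E <= (potential E F rho (ray z e a))%:E +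
    \int[mu]_(t in `[a, b]) rho (ray z e t))%E.
  rewrite -(@integral_move (fun t => rho (ray z e t)))//.
  have := @potential_ray _ E F rho mrho rho0 (ray z e a) e (b - a).
  rewrite ray_ray subrKC; under eq_integral do rewrite ray_ray.
  apply=> //; first by rewrite subr_ge0.
  move=> t; rewrite in_itv/= => /andP[? ?]; rewrite ray_ray; apply: nE.
  by rewrite in_itv/=; apply/andP; split; lra.
have bwd : ((potential E F rho (ray z e a))%:E <= (potential E F rho (ray z e b))%:E +
    \int[mu]_(t in `[a, b]) rho (ray z e t))%E.
  rewrite -(@integral_reverse (fun t => rho (ray z e t)))//.
  have := @potential_ray _ E F rho mrho rho0 (ray z e b) (- e.1, - e.2) (b - a).
  rewrite ray_opp subKr; under eq_integral do rewrite ray_opp.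
  apply=> //; first by rewrite subr_ge0.
    by rewrite !sqrrN.
  move=> t; rewrite in_itv/= => /andP[? ?]; rewrite ray_opp; apply: nE.
  by rewrite in_itv/=; apply/andP; split; lra.
move: fwd bwd.
case: (integral _ _ _) => [r| |]; last by rewrite addeNy.
  rewrite -!EFinD !lee_fin => h1 h2; rewrite ler_norml; apply/andP; split; lra.
by move=> _ _; rewrite leey.
Qed.

Lemma bounded_increment_continuous (phi : R -> R) (q : T -> \bar R) :
  measurable_fun [set: T] q -> (forall x, 0 <= q x)%E ->
  (forall n : nat, \int[mu]_(t in `[(- n%:R)%R, (n%:R)%R]) q t < +oo)%E ->
  (forall a b, a <= b -> (`|phi b - phi a|%:E <= \int[mu]_(t in `[a, b]) q t)%E) ->
  continuous phi.
Proof.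
move=> mq q0 qfin H x; apply/cvgrPdist_le => e e0.
pose n := (Num.truncn `|x|).+2.
have xn : `|x| + 1 <= n%:R.
  by rewrite /n -[X in _ <= X]natr1 lerD2r ltW// truncnS_gt.
pose D := `[- n%:R, n%:R]%classic : set T.
have mD : measurable D by exact: measurable_itv.
have mqD := measurable_patch mD mq.
have qD0 t : (0 <= (q \_ D) t)%E by rewrite patchE; case: ifP.
have Ifin : (\int[mu]_t (q \_ D) t < +oo)%E by rewrite -integral_mkcond; exact: qfin.
have [del d0 Hdel] := integral_absolutely_continuous mqD qD0 Ifin e0.
have small a b : a <= b -> b - a < del -> - n%:R <= a -> b <= n%:R -> `|phi b - phi a| <= e.
  move=> ab bad na bn; rewrite -lee_fin; apply: (le_trans (H _ _ ab)).
  have -> : (\int[mu]_(t in `[a, b]) q t = \int[mu]_(t in `[a, b]) (q \_ D) t)%E.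
    apply: eq_integral => t /set_mem /=; rewrite in_itv/= patchE => /andP[? ?].
    suff -> : t \in D by [].
    by apply/mem_set; rewrite /D /= in_itv/=; apply/andP; split; lra.
  apply: Hdel; first exact: measurable_itv.
  suff : (mu `[a, b]%classic < del%:E)%E by [].
  rewrite lebesgue_measure_itv/=; case: ifP => _; last by rewrite lte_fin.
  by rewrite -EFinB lte_fin.
exists (Num.min del 1); first by rewrite /= lt_min d0 ltr01.
move=> y /=; rewrite lt_min => /andP[xyd xy1].
have := xn; have := xy1; have := xyd; rewrite !ltr_norml => /andP[? ?] /andP[? ?] ?.
have := ler_norm x; have := ler_norm (- x); rewrite normrN => ? ?.
have [xy|yx] := leP x y; last by apply: small; lra.
by rewrite distrC; apply: small; lra.
Qed.

End line_bounds.

(** * Measurability from continuity along lines *)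

Section good_lines.
Context {R : realType}.
Notation mu := (@lebesgue_measure R).
Notation T := (measurableTypeR R).

Lemma measurable_column (f : T * T -> \bar R) x :
  measurable_fun [set: T * T] f -> measurable_fun [set: T] (fun y => f (x, y)).
Proof. by move=> mf; apply: (measurableT_comp mf); exact: pair1_measurable. Qed.

(** Almost every line avoids the null set P and, by Tonelli, carries a locally
   integrable restriction of f. *)
Lemma good_lines (P : set T) (f : T * T -> \bar R) :
  mu.-negligible P -> measurable_fun [set: T * T] f -> (forall x, 0 <= f x)%E ->
  (forall n : nat, \int[mu]_(x in `[(- n%:R)%R, n%:R%R])
     \int[mu]_(y in `[(- n%:R)%R, n%:R%R]) f (x, y) < +oo)%E ->
  exists A : set T, [/\ measurable A, mu (~` A) = 0%E, A `<=` ~` P &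
   forall x, A x -> forall n : nat,
     (\int[mu]_(y in `[(- n%:R)%R, n%:R%R]) f (x, y) < +oo)%E].
Proof.
move=> nP mf f0 ffin.
pose D (n : nat) : set T := `[- n%:R, n%:R]%classic.
have mD n : measurable (D n) by exact: measurable_itv.
pose I n x := (\int[mu]_(y in D n) f (x, y))%E.
have mI n : measurable_fun [set: T] (I n).
  exact: (@measurable_integral_on _ _ _ T T mu (D n) f).
have I0 n x : (0 <= I n x)%E by exact: integral_ge0.
pose bad n := [set x | D n x /\ I n x = +oo%E].
have nbad n : mu.-negligible (bad n).
  have : mu.-integrable (D n) (I n).
    apply/integrableP; split; first exact: measurable_funTS.
    by under eq_integral do rewrite gee0_abs//; exact: ffin.
  move/(integrable_ae (mD n)); apply: negligibleS => x [Dx Ix].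
  by move=> /(_ Dx); rewrite Ix.
have [N [mN N0 sub]] := negligibleU nP (negligible_bigcup nbad).
exists (~` N); split.
- exact: measurableC.
- by rewrite setCK.
- by move=> x Nx Px; apply: Nx; apply: sub; left.
move=> x Nx n.
pose k := maxn n (Num.truncn `|x|).+1.
have nk : (n%:R : R) <= k%:R by rewrite ler_nat leq_maxl.
have xk : `|x| <= k%:R.
  by rewrite (le_trans (ltW (truncnS_gt _)))// ler_nat leq_maxr.
apply: (@le_lt_trans _ _ (I k x)).
  apply: ge0_subset_integral => //.
  - exact: measurable_funTS (measurable_column x mf).
  - by move=> y /=; rewrite /D /= !in_itv/= => /andP[? ?]; apply/andP; split; lra.
rewrite ltey; apply/eqP => Ik; apply: Nx; apply: sub; right; exists k => //.
split=> //; rewrite /D /= in_itv/=; move: xk; rewrite ler_norml.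
by [].
Qed.

Lemma full_measure_dense (A : set T) (a b : R) : measurable A ->
  mu (~` A) = 0%E -> a < b -> exists2 x, A x & a <= x <= b.
Proof.
move=> mA A0 ab; apply: contrapT => H.
have sub : `[a, b]%classic `<=` ~` A.
  by move=> x /= xab Ax; apply: H; exists x => //; move: xab; rewrite in_itv.
have : (mu `[a, b]%classic <= 0)%E.
  by rewrite -A0; apply: le_measure => //; rewrite inE; [exact: measurable_itv|exact: measurableC].
rewrite lebesgue_measure_itv/= lte_fin ab -EFinB lee_fin; lra.
Qed.

Lemma countable_selection_measurable (g : int -> T -> R) (k : T -> int)
    (B : set T) : measurable B ->
  (forall i, measurable [set x | k x = i]) ->
  (forall i, measurable_fun [set: T] (g i)) ->
  measurable_fun ([set: T] `*` B) (fun z : T * T => g (k z.1) z.2).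
Proof.
move=> mB mk mg _ Y mY.
rewrite (_ : _ `&` _ = \bigcup_i ([set x | k x = i] `*` (B `&` g i @^-1` Y))).
  apply: countable_bigcupT_measurable => // i; apply: measurableX => //.
  by apply: measurableI => //; rewrite -[X in measurable X]setTI; exact: mg.
apply/seteqP; split=> [[x y] [[_ By] Yg]|[x y] [i _ [/= <- [By Yg]]]] //=.
by exists (k x).
Qed.

(** A function which is continuous along almost all horizontal and almost all
   vertical lines is measurable: its columns over a dense countable set of
   good abscissas are continuous, and they converge to it along good rows. *)
Lemma separately_continuous_measurable (u : T * T -> R) (A B : set T) :
  measurable A -> mu (~` A) = 0%E -> measurable B ->
  (forall x, A x -> continuous (fun y : R => u (x, y))) ->
  (forall y, B y -> continuous (fun x : R => u (x, y))) ->
  measurable_fun ([set: T] `*` B) u.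
Proof.
move=> mA A0 mB cA cB.
have : forall nk : nat * int, exists a, A a /\
    (nk.2%:~R / nk.1.+1%:R <= a <= (nk.2%:~R + 1) / nk.1.+1%:R).
  move=> [n k]; have [|a Aa ab] := @full_measure_dense A
    (k%:~R / n.+1%:R) ((k%:~R + 1) / n.+1%:R) mA A0.
    by rewrite ltr_pM2r ?invr_gt0// ltrDl.
  by exists a.
move=> /choice[a aP].
pose k n (x : T) : int := Num.floor (x * n.+1%:R).
pose h n (z : T * T) := u (a (n, k n z.1), z.2).
apply: (@measurable_fun_cvg _ _ _ _ h).
  move=> n; apply: (@countable_selection_measurable (fun i y => u (a (n, i), y)) (k n)) => //.
    move=> i; rewrite (_ : mkset _ = [set x : T | `[i%:~R, i%:~R + 1[%classic (x * n.+1%:R)]).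
      rewrite -[X in measurable X]setTI.
      have mm := @mulrr_measurable R setT n.+1%:R.
      by apply: mm => //; exact: measurable_itv.
    apply/seteqP; split=> x /=; rewrite /k in_itv/=.
      by move=> <-; have := floor_itv (x * n.+1%:R); rewrite intrD.
    by move=> H; apply: floor_def; rewrite intrD.
  by move=> i; apply: continuous_measurable_fun; apply: cA; have [] := aP (n, i).
move=> [x y] [_ /= By]; rewrite /h /=.
suff cva : (a (n, k n x) : R) @[n --> \oo] --> (x : R).
  exact: (cvg_comp _ (fun t => u (t, y)) cva (cB y By (x : R))).
apply/cvgrPdist_le => e e0.
near=> n.
have [_] := aP (n, k n x); rewrite /= => /andP[a1 a2].
have n0 : 0 < n.+1%:R :> R by [].
have /andP[k1 k2] := floor_itv (x * n.+1%:R).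
rewrite intrD -/(k n x) in k1 k2.
have ne : n.+1%:R^-1 <= e by near: n; apply: filterS (near_infty_natSinv_lt (PosNum e0)) => m /ltW.
have x1 : (k n x)%:~R / n.+1%:R <= x by rewrite ler_pdivrMr.
have x2 : x <= ((k n x)%:~R + 1) / n.+1%:R by rewrite ler_pdivlMr// ltW.
move: a2 x2; rewrite mulrDl mul1r => a2 x2.
have aux (x' a' q d c : R) : q <= a' -> a' <= q + d -> q <= x' -> x' <= q + d ->
    d <= c -> `|x' - a'| <= c.
  by move=> *; rewrite ler_norml; apply/andP; split; lra.
exact: aux a1 a2 x1 x2 ne.
Unshelve. all: by end_near. Qed.

End good_lines.

(** * Averages of integrals over translated segments *)

Section averaged_increments.
Context {R : realType}.
Notation mu := (@lebesgue_measure R).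
Notation T := (measurableTypeR R).
Implicit Types (p q z w h e : R * R) (r s d t : R) (f rho : R * R -> \bar R).
Implicit Types (E N : set (R * R)) (u : R * R -> R).

Lemma measurable_ray_param rho w e : measurable_fun [set: T * T] rho ->
  measurable_fun [set: (T * T) * T] (fun x => rho (ray (w + x.1) e x.2)).
Proof.
move=> mrho.
have F1 : measurable_fun [set: (T * T) * T] (fun x => (w.1 + x.1.1 + x.2 * e.1 : R)).
  apply: measurable_funD; last first.
    by apply: measurable_funM => //; exact: measurable_snd.
  by apply: measurable_funD => //; apply: (measurableT_comp measurable_fst); exact: measurable_fst.
have F2 : measurable_fun [set: (T * T) * T] (fun x => (w.2 + x.1.2 + x.2 * e.2 : R)).
  apply: measurable_funD; last first.
    by apply: measurable_funM => //; exact: measurable_snd.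
  by apply: measurable_funD => //; apply: (measurableT_comp measurable_snd); exact: measurable_fst.
exact: (measurableT_comp mrho (measurable_fun_pair F1 F2)).
Qed.

Definition seg_cost f w e d h := (\int[mu]_(t in `[0%R, d]) f (ray (w + h)%R e t))%E.

Lemma measurable_seg_cost f w e d : measurable_fun [set: T * T] f ->
  (forall x, 0 <= f x)%E -> measurable_fun [set: T * T] (seg_cost f w e d).
Proof.
move=> mf f0.
exact: (@measurable_integral_on _ _ _ (T * T)%type T mu `[0, d]%classic
  (fun x => f (ray (w + x.1) e x.2)) (measurable_itv _) (measurable_ray_param w e mf)
  (fun=> f0 _)).
Qed.

Lemma seg_cost_ge0 f w e d h : (forall x, 0 <= f x)%E -> (0 <= seg_cost f w e d h)%E.
Proof. by move=> f0; exact: integral_ge0. Qed.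

(** Tonelli turns the average over translates of the integral along a segment
   into the integral along the segment of the averages over squares. *)
Lemma integral_seg_cost_le f w e d r s z : measurable_fun [set: T * T] f ->
  (forall x, 0 <= f x)%E -> 0 <= d ->
  (forall t, t \in `[0, d] -> square (ray w e t) r `<=` square z s) ->
  (\int[m2 R]_(h in square 0%R r) seg_cost f w e d h <= d%:E * sq_mass f s z)%E.
Proof.
move=> mf f0 d0 sub; rewrite /seg_cost.
have -> : (\int[m2 R]_(h in square 0%R r) \int[mu]_(t in `[0%R, d]) f (ray (w + h)%R e t) =
   \int[mu]_(t in `[0%R, d]) \int[m2 R]_(h in square 0%R r) f (ray (w + h)%R e t))%E.
  apply: (@tonelli_on _ _ (T * T)%type T R area mu (square 0 r) `[0, d]%classic
    (fun x => f (ray (w + x.1) e x.2))) => //.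
  - exact: measurable_sq.
  - exact: measurable_ray_param.
have -> : (d%:E * sq_mass f s z = \int[mu]_(t in `[0%R, d]) sq_mass f s z)%E.
  rewrite integral_cst; last exact: measurable_itv.
  rewrite muleC; congr (_ * _)%E.
  suff : mu `[0, d]%classic = d%:E by move=> <-.
  rewrite lebesgue_measure_itv/= lte_fin; have [//|d_le0] := ltP 0 d.
    by rewrite sube0.
  by congr EFin; apply/eqP; rewrite eq_le d0 d_le0.
apply: ge0_le_integral => //.
- by move=> t _; exact: integral_ge0.
- apply: measurable_funTS.
  apply: (@measurable_integral_on _ _ _ T (T * T)%type area (square 0 r)
    (fun x => f (ray (w + x.2) e x.1))) => //; first exact: measurable_sq.
  have sw : measurable_fun [set: T * (T * T)] (fun x => (x.2, x.1)).
    exact: (measurable_fun_pair measurable_snd measurable_fst).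
  exact: (measurableT_comp (measurable_ray_param w e mf) sw).
- move=> t td; rewrite /sq_mass.
  have -> : (\int[m2 R]_(h in square 0%R r) f (ray (w + h)%R e t) =
     \int[m2 R]_(h in square 0%R r) f (ray w e t + h)%R)%E.
    by apply: eq_integral => h _; congr f; congr pair => /=; ring.
  rewrite integral_sq//; apply: integral_sq_le => //; exact: sub.
Qed.

End averaged_increments.

(** * Increments across the exceptional set *)

Section increments.
Context {R : realType}.
Notation mu := (@lebesgue_measure R).
Notation T := (measurableTypeR R).
Implicit Types (p q z w h e : R * R) (r s d t : R) (f rho : R * R -> \bar R).
Implicit Types (E N : set (R * R)) (u : R * R -> R).

Definition sgn1 (x : R) : R := if 0 <= x then 1 else -1.

Lemma sgn1_sqr x : sgn1 x ^+ 2 = 1.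
Proof. by rewrite /sgn1; case: ifP => _; rewrite ?sqrrN expr1n. Qed.

Lemma sgn1_norm x : `|x| * sgn1 x = x.
Proof.
rewrite /sgn1; case: ifPn => [x0|]; first by rewrite ger0_norm// mulr1.
by rewrite -ltNge => x0; rewrite ltr0_norm// mulrN1 opprK.
Qed.

Lemma norm_sgn1 x : `|sgn1 x| = 1.
Proof. by rewrite /sgn1; case: ifP => _; rewrite ?normrN normr1. Qed.

Lemma unit_coord_le1 e : e.1 ^+ 2 + e.2 ^+ 2 = 1 -> `|e.1| <= 1 /\ `|e.2| <= 1.
Proof.
by move=> e1; split; rewrite ler_norml; apply/andP; split;
  have := sqr_ge0 e.1; have := sqr_ge0 e.2; nra.
Qed.

Lemma ray_dist w e t : e.1 ^+ 2 + e.2 ^+ 2 = 1 -> 0 <= t ->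
  `|(ray w e t).1 - w.1| <= t /\ `|(ray w e t).2 - w.2| <= t.
Proof.
move=> /unit_coord_le1[e1 e2] t0.
by rewrite /ray /= ![w.1 + _]addrC ![w.2 + _]addrC !addrK !normrM !(ger0_norm t0) !ler_piMr.
Qed.

Lemma integral_itv_le (f : T -> \bar R) a b : measurable_fun [set: T] f ->
  (forall x, 0 <= f x)%E -> a <= b ->
  (\int[mu]_(t in `[0%R, a]) f t <= \int[mu]_(t in `[0%R, b]) f t)%E.
Proof.
move=> mf f0 ab; apply: ge0_subset_integral => //; first exact: measurable_funTS.
by move=> x /=; rewrite !in_itv/= => /andP[-> xa]; exact: le_trans ab.
Qed.

Variables (E N : set (R * R)) (rho : R * R -> \bar R) (u : R * R -> R) (s : R).
Hypothesis mrho : measurable_fun [set: T * T] rho.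
Hypothesis rho0 : forall x, (0 <= rho x)%E.
Hypothesis urho : line_bounded E rho u.
Hypothesis mN : measurable (N : set (T * T)).
Hypothesis EN : forall z x, E x -> `|z.1 - x.1| <= 3 * s -> `|z.2 - x.2| <= 3 * s -> N z.

Lemma patch_ge0 x : (0 <= (rho \_ N) x)%E.
Proof. by rewrite patchE; case: ifP. Qed.

Lemma measurable_rhoN : measurable_fun [set: T * T] (rho \_ N).
Proof. exact: (@measurable_patch _ (T * T)%type _ _ _ mN mrho). Qed.

Lemma axis_increment_le w e c d : e.1 ^+ 2 + e.2 ^+ 2 = 1 -> 0 <= c -> c <= d ->
  (forall t, t \in `[0, c] -> ~ E (ray w e t)) ->
  (forall t, t \in `[0, c] -> N (ray w e t)) ->
  (`|u (ray w e c) - u w|%:E <= \int[mu]_(t in `[0%R, d]) (rho \_ N) (ray w e t))%E.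
Proof.
move=> e1 c0 cd nE inN.
have := urho e1 c0 nE; rewrite ray0 => /le_trans; apply.
apply: le_trans (integral_itv_le (measurable_ray w e measurable_rhoN) (fun=> patch_ge0 _) cd).
rewrite le_eqVlt; apply/orP; left; apply/eqP; apply: eq_integral => t /set_mem tc.
suff -> : (rho \_ N) (ray w e t) = rho (ray w e t) by [].
by rewrite patchE ifT//; apply/mem_set; exact: inN.
Qed.

(** A segment that meets E is replaced by an L-shaped path along two lines
   that miss E; the whole path then stays in the neighbourhood N of E. *)
Lemma increment_le w e d : e.1 ^+ 2 + e.2 ^+ 2 = 1 -> 0 <= d -> d <= s ->
  ~ (snd @` E) w.2 -> ~ (fst @` E) (w.1 + d * e.1) ->
  ((u (ray w e d))%:E <= (u w)%:E +
    (\int[mu]_(t in `[0%R, d]) rho (ray w e t) +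
     \int[mu]_(t in `[0%R, d]) (rho \_ N) (ray w (sgn1 e.1, 0%R) t) +
     \int[mu]_(t in `[0%R, d]) (rho \_ N) (ray (ray w (e.1, 0%R) d) (0%R, sgn1 e.2) t)))%E.
Proof.
move=> e1 d0 ds nE2 nE1.
set I1 := (X in (_ + (X + _ + _))%E); set I2 := (X in (_ + (_ + X + _))%E).
set I3 := (X in (_ + (_ + X))%E).
have I10 : (0 <= I1)%E by exact: integral_ge0.
have I20 : (0 <= I2)%E by apply: integral_ge0 => t _; exact: patch_ge0.
have I30 : (0 <= I3)%E by apply: integral_ge0 => t _; exact: patch_ge0.
have [clear|] := pselect (forall t, t \in `[0, d] -> ~ E (ray w e t)).
  have := urho e1 d0 clear; rewrite ray0 -/I1 => H.
  have -> : (u (ray w e d))%:E = ((u w)%:E + (u (ray w e d) - u w)%:E)%E.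
    by rewrite -EFinD subrKC.
  apply: leeD => //; apply: (@le_trans _ _ I1).
    by apply: le_trans H; rewrite lee_fin ler_norm.
  by rewrite -addeA leeDl// adde_ge0.
move=> /existsNP[t0 /not_implyP[t0d /contrapT Ex]].
have := t0d; rewrite in_itv/= => /andP[t00 t0d'].
have [x1 x2] := ray_dist w e1 t00.
have [e11 e21] := unit_coord_le1 e1.
pose w1 := ray w (e.1, 0) d.
have c1d : `|e.1| * d <= d by rewrite ler_piMl.
have c2d : `|e.2| * d <= d by rewrite ler_piMl.
have w1E : w1 = ray w (sgn1 e.1, 0) (`|e.1| * d).
  by rewrite /w1 /ray /= !mulr0 mulrAC sgn1_norm mulrC.
have wE : ray w e d = ray w1 (0, sgn1 e.2) (`|e.2| * d).
  by rewrite /w1 /ray /= !mulr0 !addr0 (mulrAC `|e.2|) sgn1_norm [d * e.2]mulrC.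
have near z : `|z.1 - w.1| <= d -> `|z.2 - w.2| <= d -> N z.
  move=> h1 h2; apply: (EN Ex).
    rewrite (_ : z.1 - _ = (z.1 - w.1) - ((ray w e t0).1 - w.1)); last by ring.
    by rewrite (le_trans (ler_normB _ _))//; lra.
  rewrite (_ : z.2 - _ = (z.2 - w.2) - ((ray w e t0).2 - w.2)); last by ring.
  by rewrite (le_trans (ler_normB _ _))//; lra.
have H1 : (`|u w1 - u w|%:E <= I2)%E.
  rewrite w1E; apply: axis_increment_le => //=.
  - by rewrite sgn1_sqr expr0n addr0.
  - by rewrite mulr_ge0.
  - move=> t _ EE; apply: nE2; exists (ray w (sgn1 e.1, 0) t) => //.
    by rewrite /ray /= mulr0 addr0.
  - move=> t; rewrite in_itv/= => /andP[tt0 tc]; apply: near; rewrite /ray /=.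
      by rewrite addrC addKr normrM norm_sgn1 mulr1 ger0_norm// (le_trans tc).
    by rewrite mulr0 addr0 subrr normr0.
have H2 : (`|u (ray w e d) - u w1|%:E <= I3)%E.
  rewrite wE; apply: axis_increment_le => //=.
  - by rewrite sgn1_sqr expr0n add0r.
  - by rewrite mulr_ge0.
  - move=> t _ EE; apply: nE1; exists (ray w1 (0, sgn1 e.2) t) => //.
    by rewrite /w1 /ray /= mulr0 addr0.
  - move=> t; rewrite in_itv/= => /andP[tt0 tc]; apply: near; rewrite /w1 /ray /= !mulr0 !addr0.
      by rewrite addrC addKr normrM (ger0_norm d0) mulrC.
    by rewrite addrC addKr normrM norm_sgn1 mulr1 ger0_norm// (le_trans tc).
have -> : (u (ray w e d))%:E = ((u w)%:E + ((u w1 - u w) + (u (ray w e d) - u w1))%:E)%E.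
  by rewrite -EFinD; congr EFin; ring.
apply: leeD => //; apply: (@le_trans _ _ (I2 + I3)%E).
  rewrite EFinD; apply: leeD; [apply: le_trans H1|apply: le_trans H2];
    by rewrite lee_fin ler_norm.
by rewrite leeD2r// -[leLHS]add0e leeD2r.
Qed.

End increments.

(** * Increments of the averages *)

Section negligible_lines.
Context {R : realType}.
Notation mu := (@lebesgue_measure R).
Notation T := (measurableTypeR R).

Lemma negligible_shift (P : set T) c : mu.-negligible P ->
  mu.-negligible [set x : T | P (c + x)].
Proof.
move=> [N [mN N0 PN]].
have mS : measurable [set x : T | N (x + c)].
  rewrite -[X in measurable X]setTI.
  have mc : measurable_fun [set: T] (fun x : T => (x + c : R)) by exact: measurable_funD.
  exact: mc.
exists [set x : T | N (x + c)]; split => //; last first.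
  by move=> x /= /PN; rewrite addrC.
have cst1 A : measurable A -> (\int[mu]_(x in A) cst 1%E x = mu A)%E.
  by move=> mA; rewrite integral_cst// mul1e.
rewrite -(cst1 _ mS) -[RHS]N0 -(cst1 _ mN).
exact: (@integral_shift R c N (cst 1%E) mN (measurable_cst _) (fun _ _ => lee01)).
Qed.

Lemma negligible_reflect (P : set T) c : mu.-negligible P ->
  mu.-negligible [set x : T | P (c - x)].
Proof.
move=> /(negligible_shift c)[N [mN N0 PN]].
have mS : measurable [set x : T | N (- x)].
  rewrite -[X in measurable X]setTI.
  have mc : measurable_fun [set: T] (fun x : T => (- x : R)) by exact: oppr_measurable.
  exact: mc.
exists [set x : T | N (- x)]; split => //; last by move=> x /= /PN.
have cst1 A : measurable A -> (\int[mu]_(x in A) cst 1%E x = mu A)%E.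
  by move=> mA; rewrite integral_cst// mul1e.
rewrite -(cst1 _ mS) -[RHS]N0 -(cst1 _ mN).
exact: (@integral_reflect R N (cst 1%E) mN (measurable_cst _) (fun _ _ => lee01)).
Qed.

Lemma negligible_fst (P : set T) : mu.-negligible P ->
  (m2 R).-negligible [set z : T * T | P z.1].
Proof.
move=> [N [mN N0 PN]]; exists (N `*` [set: T]); split.
- exact: measurableX.
- by rewrite product_measure1E// -[X in (X * _)%E]/(mu N) N0 mul0e.
- by move=> z /= /PN.
Qed.

Lemma negligible_snd (P : set T) : mu.-negligible P ->
  (m2 R).-negligible [set z : T * T | P z.2].
Proof.
move=> [N [mN N0 PN]]; exists ([set: T] `*` N); split.
- exact: measurableX.
- by rewrite product_measure1E// -[X in (_ * X)%E]/(mu N) N0 mule0.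
- by move=> z /= /PN.
Qed.

End negligible_lines.

Section averages.
Context {R : realType}.
Notation mu := (@lebesgue_measure R).
Notation T := (measurableTypeR R).
Implicit Types (p q z w h e : R * R) (r s d t : R).
Variables (E : set (R * R)) (rho : R * R -> \bar R) (u uh : R * R -> R) (Bad : set R).
Hypothesis hE1 : mu.-negligible (fst @` E).
Hypothesis hE2 : mu.-negligible (snd @` E).
Hypothesis mrho : measurable_fun [set: T * T] rho.
Hypothesis rho0 : forall x, (0 <= rho x)%E.
Hypothesis urho : line_bounded E rho u.
Hypothesis muh : measurable_fun [set: T * T] uh.
Hypothesis uh0 : forall z, 0 <= uh z.
Hypothesis hBad : mu.-negligible Bad.
Hypothesis uhE : forall z, ~ Bad z.2 -> uh z = u z.

Definition sq_avg r p := (\int[m2 R]_(h in square 0%R r) (uh (p + h)%R)%:E)%E.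

Lemma measurable_uh_shift p : measurable_fun [set: T * T] (fun h => (uh (p + h)%R)%:E).
Proof.
by apply/measurable_EFinP; exact: (measurableT_comp muh (measurable_translation p)).
Qed.

(** Integrate increment_le over the translates: for almost every h the lines
   through p + h and q + h that it uses miss E, because the projections of E
   are null. The point z is free, so that the bound can be integrated along a
   curve without continuity of the masses; 2 * s makes room for the length of
   the segment and for the distance to z. *)
Lemma sq_avg_step (N : set (R * R)) r s p q z :
  measurable (N : set (T * T)) -> 0 < r ->
  (forall z x, E x -> `|z.1 - x.1| <= 3 * s -> `|z.2 - x.2| <= 3 * s -> N z) ->
  euclidean_dist p q <= s -> euclidean_dist p z <= s ->
  (sq_avg r q <= sq_avg r p + (euclidean_dist p q)%:E *
     sq_mass (fun x => rho x + 2%:E * (rho \_ N) x) (r + 2 * s) z)%E.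
Proof.
move=> mN r0 EN pqs pzs.
have mrN : measurable_fun [set: T * T] (rho \_ N) := measurable_rhoN mrho mN.
have rN0 := patch_ge0 N rho0.
have mF : measurable_fun [set: T * T] (fun x => rho x + 2%:E * (rho \_ N) x)%E.
  by apply: emeasurable_funD => //; exact: measurable_funeM.
have F0 x : (0 <= rho x + 2%:E * (rho \_ N) x)%E by rewrite adde_ge0// mule_ge0.
set d := euclidean_dist p q; have d0 : 0 <= d := edist_ge0 p q.
have [d_le0|dpos] := leP d 0.
  by rewrite -(edist_eq0 d_le0) leeDl// mule_ge0 ?lee_fin// sq_mass_ge0.
pose e := ((q.1 - p.1) / d, (q.2 - p.2) / d).
have dn0 : d != 0 by rewrite gt_eqF.
have d2 : d ^+ 2 = (q.1 - p.1) ^+ 2 + (q.2 - p.2) ^+ 2.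
  rewrite /d /euclidean_dist sqr_sqrtr ?addr_ge0 ?sqr_ge0//; ring.
have e1 : e.1 ^+ 2 + e.2 ^+ 2 = 1.
  by rewrite /e /= !exprMn -mulrDl -d2 exprVn divff// expf_neq0.
have qE : q = ray p e d.
  by rewrite /ray /e /= ![d * _]mulrC !divfK// !subrKC; case: (q).
pose w1 := ray p (e.1, 0) d.
pose C1 := seg_cost rho p e d; pose C2 := seg_cost (rho \_ N) p (sgn1 e.1, 0) d.
pose C3 := seg_cost (rho \_ N) w1 (0, sgn1 e.2) d.
have mC1 : measurable_fun [set: T * T] C1 by exact: measurable_seg_cost.
have mC2 : measurable_fun [set: T * T] C2 by exact: measurable_seg_cost.
have mC3 : measurable_fun [set: T * T] C3 by exact: measurable_seg_cost.
have C10 h : (0 <= C1 h)%E by exact: seg_cost_ge0.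
have C20 h : (0 <= C2 h)%E by exact: seg_cost_ge0.
have C30 h : (0 <= C3 h)%E by exact: seg_cost_ge0.
have C120 h : (0 <= C1 h + C2 h)%E := adde_ge0 (C10 h) (C20 h).
have C0 h : (0 <= C1 h + C2 h + C3 h)%E := adde_ge0 (C120 h) (C30 h).
have uhE0 h : (0 <= (uh h)%:E)%E by rewrite lee_fin.
have ae : {ae m2 R, forall h, square 0 r h ->
    ((uh (q + h)%R)%:E <= (uh (p + h)%R)%:E + (C1 h + C2 h + C3 h))%E}.
  have n1 := negligible_fst (negligible_shift (p.1 + d * e.1) hE1).
  have n2 := negligible_snd (negligible_shift p.2 hE2).
  have n3 := negligible_snd (negligible_shift p.2 hBad).
  have n4 := negligible_snd (negligible_shift q.2 hBad).
  apply: negligibleS (negligibleU (negligibleU n1 n2) (negligibleU n3 n4)).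
  move=> h /=; apply: contra_notP.
  move=> /not_orP[/not_orP[/= g1 g2] /not_orP[/= g3 g4]] _.
  rewrite !uhE//.
  have := @increment_le _ E N rho u s mrho rho0 urho mN EN (p + h) e d e1 d0 pqs g2.
  have -> : (p + h).1 + d * e.1 = p.1 + d * e.1 + h.1 by rewrite /=; ring.
  move=> /(_ g1).
  have -> : ray (p + h) e d = q + h by rewrite qE; congr pair => /=; ring.
  suff -> : ray (p + h) (e.1, 0) d = w1 + h by [].
  by congr pair => /=; ring.
have coords := unit_coord_le1 e1.
have [pz1 pz2] : `|p.1 - z.1| <= s /\ `|p.2 - z.2| <= s.
  by split; [apply: le_trans (edist_fst p z) _|apply: le_trans (edist_snd p z) _].
have near w : `|w.1 - p.1| <= d -> `|w.2 - p.2| <= d -> square w r `<=` square z (r + 2 * s).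
  move=> h1 h2; apply: sq_sub.
    rewrite (_ : w.1 - z.1 = (w.1 - p.1) + (p.1 - z.1)); last by ring.
    by rewrite (le_trans (ler_normD _ _))//; rewrite -/d in pqs; lra.
  rewrite (_ : w.2 - z.2 = (w.2 - p.2) + (p.2 - z.2)); last by ring.
  by rewrite (le_trans (ler_normD _ _))//; rewrite -/d in pqs; lra.
have I1 : (\int[m2 R]_(h in square 0%R r) C1 h <= d%:E * sq_mass rho (r + 2 * s) z)%E.
  apply: integral_seg_cost_le => // t; rewrite in_itv/= => /andP[t0 td].
  have [h1 h2] := ray_dist p e1 t0.
  by apply: near; [exact: le_trans h1 td|exact: le_trans h2 td].
have I2 : (\int[m2 R]_(h in square 0%R r) C2 h <= d%:E * sq_mass (rho \_ N) (r + 2 * s) z)%E.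
  apply: integral_seg_cost_le => // t; rewrite in_itv/= => /andP[t0 td].
  apply: near; rewrite /ray /=.
    by rewrite addrC addKr normrM norm_sgn1 mulr1 ger0_norm.
  by rewrite mulr0 addr0 subrr normr0.
have I3 : (\int[m2 R]_(h in square 0%R r) C3 h <= d%:E * sq_mass (rho \_ N) (r + 2 * s) z)%E.
  apply: integral_seg_cost_le => // t; rewrite in_itv/= => /andP[t0 td].
  apply: near; rewrite /w1 /ray /= !mulr0 !addr0.
    by rewrite addrC addKr normrM (ger0_norm d0) ler_piMr//; case: coords.
  by rewrite addrC addKr normrM norm_sgn1 mulr1 ger0_norm.
have mS := measurable_sq (0 : R * R) r.
apply: (@le_trans _ _ (\int[m2 R]_(h in square 0%R r) ((uh (p + h)%R)%:E + (C1 h + C2 h + C3 h)))%E).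
  apply: ae_ge0_le_integral => //.
  - exact: measurable_funTS (measurable_uh_shift q).
  - by move=> h _; exact: adde_ge0 (uhE0 _) (C0 h).
  - apply: measurable_funTS; apply: emeasurable_funD; first exact: measurable_uh_shift.
    by apply: emeasurable_funD => //; exact: emeasurable_funD.
rewrite ge0_integralD//; last 2 first.
- exact: measurable_funTS (measurable_uh_shift p).
- by apply: measurable_funTS; apply: emeasurable_funD => //; exact: emeasurable_funD.
apply: leeD => //.
rewrite ge0_integralD//; last 2 first.
- by apply: measurable_funTS; exact: emeasurable_funD.
- exact: measurable_funTS.
rewrite ge0_integralD//; last 2 first.
- exact: measurable_funTS.
- exact: measurable_funTS.
apply: le_trans (leeD (leeD I1 I2) I3) _.
have M10 := sq_mass_ge0 (r + 2 * s) z rho0.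
have M20 := sq_mass_ge0 (r + 2 * s) z rN0.
have -> : sq_mass (fun x => rho x + 2%:E * (rho \_ N) x)%E (r + 2 * s) z =
    (sq_mass rho (r + 2 * s) z + 2%:E * sq_mass (rho \_ N) (r + 2 * s) z)%E.
  have mS' := measurable_sq z (r + 2 * s).
  rewrite /sq_mass ge0_integralD//; last 3 first.
  - exact: measurable_funTS.
  - by move=> x _; rewrite mule_ge0.
  - by apply: measurable_funTS; exact: measurable_funeM.
  by rewrite ge0_integralZl_EFin//; exact: measurable_funTS.
move: M10 M20; move: (sq_mass rho _ _) (sq_mass (rho \_ N) _ _) => M1 M2 M10 M20.
have -> : (2%:E * M2 = M2 + M2)%E by rewrite -mule2n -mule_natl.
by rewrite !ge0_muleDr ?adde_ge0// addeA.
Qed.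

End averages.

(** * From increments to line integrals *)

Section chaining.
Context {R : realType}.
Notation mu := (@lebesgue_measure R).
Notation T := (measurableTypeR R).
Implicit Types (p q z : R * R).

(** A Riemann sum argument: an increment estimate over short distances, with
   the bound taken at an arbitrary nearby point, integrates along curves. *)
Lemma increment_along_short_map (Phi : R * R -> R) (G : R * R -> \bar R) (s : R)
    (c : R -> R * R) (l : R) :
  measurable_fun [set: T * T] G -> (forall x, 0 <= G x)%E -> 0 < s ->
  (forall p q z, euclidean_dist p q <= s -> euclidean_dist p z <= s ->
     ((Phi q)%:E <= (Phi p)%:E + (euclidean_dist p q)%:E * G z)%E) ->
  0 <= l -> short_map c l ->
  ((Phi (c l))%:E <= (Phi (c 0%R))%:E + \int[mu]_(t in `[0%R, l]) G (c t))%E.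
Proof.
move=> mG G0 s0 step l0 cl.
have mGc : measurable_fun (`[0, l] : set T) (fun t => G (c t)) := short_map_measurable l0 cl mG.
have piece a b : 0 <= a -> a <= b -> b <= l -> b - a <= s ->
    ((Phi (c b))%:E <= (Phi (c a))%:E + \int[mu]_(t in `]a, b]) G (c t))%E.
  move=> a0 ab bl bas.
  have inI t : a <= t -> t <= b -> t \in `[0, l].
    by move=> at_ tb; rewrite in_itv/= (le_trans a0 at_) (le_trans tb bl).
  have I0 : (0 <= \int[mu]_(t in `]a, b]) G (c t))%E by exact: integral_ge0.
  have [le|lt] := leP (Phi (c b)) (Phi (c a)).
    by rewrite (@le_trans _ _ (Phi (c a))%:E) ?lee_fin// leeDl.
  have abs : a < b.
    by rewrite lt_neqAle ab andbT; apply: contraTneq lt => ->; rewrite ltxx.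
  pose k := (Phi (c b) - Phi (c a)) / (b - a).
  have ba0 : 0 < b - a by rewrite subr_gt0.
  have k0 : 0 <= k by rewrite divr_ge0 ?subr_ge0// ltW.
  have kG t : a <= t -> t <= b -> (k%:E <= G (c t))%E.
    move=> at_ tb.
    have d1 : euclidean_dist (c a) (c b) <= b - a.
      by rewrite (le_trans (cl _ _ (inI _ _ _) (inI _ _ _)))// distrC ger0_norm// ltW.
    have d2 : euclidean_dist (c a) (c t) <= s.
      rewrite (le_trans (cl _ _ (inI _ _ _) (inI _ _ _)))// distrC ger0_norm ?subr_ge0//.
      by rewrite (le_trans _ bas)// lerD2r.
    have := step _ _ _ (le_trans d1 bas) d2.
    have := G0 (c t); case: (G (c t)) => [g| |]//; last by move=> _ _; rewrite leey.
    rewrite !lee_fin => g0; rewrite -lerBlDl => H.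
    rewrite /k ler_pdivrMr// (le_trans H)// mulrC.
    by rewrite ler_wpM2l.
  have -> : (Phi (c b))%:E = ((Phi (c a))%:E + (k * (b - a))%:E)%E.
    by rewrite -EFinD /k divfK ?gt_eqF// subrKC.
  apply: leeD => //.
  have -> : (k * (b - a))%:E = (\int[mu]_(t in `]a, b]) k%:E)%E.
    rewrite integral_cst; last exact: measurable_itv.
    rewrite EFinM; congr (_ * _)%E.
    suff : mu `]a, b]%classic = (b - a)%:E by move=> <-.
    by rewrite lebesgue_measure_itv/= lte_fin abs.
  apply: ge0_le_integral => //.
  - apply: measurable_funS mGc => //.
    by move=> t /=; rewrite !in_itv/= => /andP[? ?]; apply/andP; split; lra.
  - by move=> t /=; rewrite in_itv/= => /andP[/ltW at_ tb]; exact: kG.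
pose N := (Num.truncn (l / s)).+1.
pose dl := l / N%:R.
have N0 : 0 < N%:R :> R by rewrite ltr0n.
have dl0 : 0 <= dl by rewrite divr_ge0// ltW.
have dls : dl <= s.
  by rewrite ler_pdivrMr// mulrC -ler_pdivrMr// ltW// truncnS_gt.
have NdlE : N%:R * dl = l by rewrite mulrC divfK// gt_eqF.
have main (k : nat) : (k <= N)%N -> ((Phi (c (k%:R * dl)))%:E <=
    (Phi (c 0%R))%:E + \int[mu]_(t in `[0%R, (k%:R * dl)%R]) G (c t))%E.
  elim: k => [_|k IH kN].
    by rewrite mul0r set_itv1 integral_set1 adde0.
  have kl : k.+1%:R * dl <= l by rewrite -NdlE ler_wpM2r// ler_nat.
  have kk : k%:R * dl <= k.+1%:R * dl by rewrite ler_wpM2r// ler_nat.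
  have k0 : 0 <= k%:R * dl by rewrite mulr_ge0.
  have E : `[0, k.+1%:R * dl]%classic = `[0, k%:R * dl] `|` `]k%:R * dl, k.+1%:R * dl] :> set R.
    by apply: itv_bndbnd_setU; rewrite bnd_simp.
  rewrite E ge0_integral_setU//=; last 2 first.
  - apply: measurable_funS mGc => //; rewrite -E.
    by move=> t /=; rewrite !in_itv/= => /andP[-> /le_trans]; apply.
  - apply/disj_set2P/seteqP; split => // x /=; rewrite !in_itv/= => -[/andP[_ xl] /andP[lx _]].
    by rewrite ltNge xl in lx.
  rewrite addeA; apply: le_trans (leeD (IH (ltnW kN)) (lexx _)).
  apply: piece => //.
  by rewrite -mulrBl -natrB// subSnn mul1r.
by have := main N (leqnn N); rewrite NdlE.
Qed.

End chaining.

(** * Boundary values of the averages *)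

Lemma mule4 (R : realType) (x : \bar R) : (0 <= x)%E ->
  (x + x + (x + x) = 4%:E * x)%E.
Proof.
case: x => [r _| _|//]; last by rewrite gt0_muley ?lte_fin.
by rewrite -EFinM -!EFinD; congr EFin; ring.
Qed.

Section boundary_values.
Context {R : realType}.
Notation mu := (@lebesgue_measure R).
Notation T := (measurableTypeR R).
Implicit Types (p q z w h e : R * R) (r s x y : R).

(** The norm of R * R is the sup norm, so that these spheres are the
   boundaries of the squares around p. *)
Lemma connected_meets_spheres (F : set (R * R)) p q r s : connected F -> F p ->
  F q -> r <= `|q - p| -> 0 <= s -> s <= r -> exists2 w, F w & `|w - p| = s.
Proof.
move=> cF Fp Fq rq s0 sr.
have : connected [set `|w - p| | w in F].
  apply: connected_continuous_connected cF _.
  apply: continuous_subspaceT => z.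
  by apply: cvg_norm; apply: cvgB; [exact: cvg_id|exact: cvg_cst].
move=> /connected_intervalP /(_ 0 `|q - p|) H.
have [|||w Fw ws] := H _ _ s; last by exists w.
- by exists p => //; rewrite subrr normr0.
- by exists q.
- by rewrite s0 (le_trans sr).
Qed.

Variables (E : set (R * R)) (rho : R * R -> \bar R) (u : R * R -> R).
Hypothesis mrho : measurable_fun [set: T * T] rho.
Hypothesis rho0 : forall z, (0 <= rho z)%E.
Hypothesis urho : line_bounded E rho u.
Variables (p : R * R) (r : R).
Hypothesis r0 : 0 < r.

Definition col_mass x := (\int[mu]_(t in `[(- r)%R, r]) rho (p + (x, t))%R)%E.
Definition row_mass y := (\int[mu]_(t in `[(- r)%R, r]) rho (p + (t, y))%R)%E.
(** The mass of rho on the four lines that carry the sides of the square of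
   half-side s around p, cut off at distance r. *)
Definition cross_mass s :=
  (col_mass s + col_mass (- s)%R + (row_mass s + row_mass (- s)%R))%E.

Lemma col_mass_ge0 x : (0 <= col_mass x)%E. Proof. exact: integral_ge0. Qed.
Lemma row_mass_ge0 x : (0 <= row_mass x)%E. Proof. exact: integral_ge0. Qed.
Lemma cross_mass_ge0 x : (0 <= cross_mass x)%E.
Proof.
exact: adde_ge0 (adde_ge0 (col_mass_ge0 _) (col_mass_ge0 _))
  (adde_ge0 (row_mass_ge0 _) (row_mass_ge0 _)).
Qed.

Lemma cross_massN s : cross_mass (- s) = cross_mass s.
Proof. by rewrite /cross_mass opprK [X in (X + _)%E]addeC [X in (_ + X)%E]addeC. Qed.

Lemma line_move (z e : R * R) (f : R -> R * R) a b : e.1 ^+ 2 + e.2 ^+ 2 = 1 ->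
  (forall t, ray z e t = f t) -> (forall t, ~ E (f t)) ->
  - r <= a <= r -> - r <= b <= r ->
  (`|u (f b) - u (f a)|%:E <= \int[mu]_(t in `[(- r)%R, r]) rho (f t))%E.
Proof.
move=> e1 fE nE; wlog ab : a b / a <= b.
  move=> H ar br; have [|/ltW] := leP a b; first by move=> ab; exact: H.
  by move=> ba; rewrite distrC; exact: H.
move=> /andP[ra ar] /andP[rb br].
have nE' t : t \in `[a, b] -> ~ E (ray z e t) by rewrite fE.
have := urho e1 ab nE'; rewrite !fE => /le_trans; apply.
under eq_integral do rewrite fE.
apply: ge0_subset_integral => //.
- apply: measurable_funTS; apply: (@eq_measurable_fun _ _ _ _ _ (fun t => rho (ray z e t))).
    by move=> t _; rewrite fE.
  exact: measurable_ray.
- by move=> t /=; rewrite !in_itv/= => /andP[? ?]; apply/andP; split; lra.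
Qed.

Lemma col_move x a b : ~ (fst @` E) (p.1 + x) ->
  - r <= a <= r -> - r <= b <= r ->
  (`|u (p + (x, b))%R - u (p + (x, a))%R|%:E <= col_mass x)%E.
Proof.
move=> nE; apply: (@line_move (p.1 + x, p.2) (0, 1) (fun t => p + (x, t))).
- by rewrite /= expr0n expr1n add0r.
- by move=> t; rewrite /ray /= mulr0 addr0 mulr1.
- by move=> t Et; apply: nE; exists (p + (x, t)).
Qed.

Lemma row_move y a b : ~ (snd @` E) (p.2 + y) ->
  - r <= a <= r -> - r <= b <= r ->
  (`|u (p + (b, y))%R - u (p + (a, y))%R|%:E <= row_mass y)%E.
Proof.
move=> nE; apply: (@line_move (p.1, p.2 + y) (1, 0) (fun t => p + (t, y))).
- by rewrite /= expr0n expr1n addr0.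
- by move=> t; rewrite /ray /= mulr0 addr0 mulr1.
- by move=> t Et; apply: nE; exists (p + (t, y)).
Qed.

(** Each boundary point of the square of half-side s reaches its corner
   p + (s, s) along at most two of the four sides. *)
Lemma corner_move s x y : s <= r -> Num.max `|x| `|y| = s ->
  ~ (fst @` E) (p.1 + s) -> ~ (fst @` E) (p.1 - s) ->
  ~ (snd @` E) (p.2 + s) -> ~ (snd @` E) (p.2 - s) ->
  (`|u (p + (x, y))%R - u (p + (s, s))%R|%:E <= cross_mass s)%E.
Proof.
move=> sr xys n1 n2 n3 n4.
have V := col_mass_ge0; have H := row_mass_ge0.
have [xs ys] : `|x| <= s /\ `|y| <= s by rewrite -xys !le_max !lexx orbT.
have s0 : 0 <= s := le_trans (normr_ge0 _) xs.
have yr : - r <= y <= r by move: ys; rewrite ler_norml => /andP[? ?]; apply/andP; split; lra.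
have xr : - r <= x <= r by move: xs; rewrite ler_norml => /andP[? ?]; apply/andP; split; lra.
have sr' : - r <= s <= r by apply/andP; split; lra.
have two (A B : \bar R) (a b c : R) : (`|a - b|%:E <= A)%E -> (`|b - c|%:E <= B)%E ->
    (`|a - c|%:E <= A + B)%E.
  move=> h1 h2; apply: le_trans (leeD h1 h2).
  by rewrite -EFinD lee_fin ler_distD.
have cases : [\/ x = s, x = - s, y = s | y = - s].
  move: xys; rewrite /Num.max; case: ltP => _ <-.
    have [h|h] := ler0P y; [apply: Or44|apply: Or43]; lra.
  have [h|h] := ler0P x; [apply: Or42|apply: Or41]; lra.
case: cases => E1; rewrite E1.
- apply: le_trans (col_move n1 sr' yr) _.
  by rewrite /cross_mass -addeA leeDl//; exact: adde_ge0 (V _) (adde_ge0 (H _) (H _)).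
- apply: (le_trans (two _ _ _ _ _ (col_move n2 sr' yr) (row_move (a := s) (b := - s) n3 _ _))) => //.
    by apply/andP; split; lra.
  rewrite /cross_mass; apply: leeD; last by rewrite leeDl.
  by rewrite -[leLHS]add0e leeD2r.
- apply: le_trans (row_move n3 sr' xr) _.
  by rewrite /cross_mass addeC -addeA leeDl//; exact: adde_ge0 (H _) (adde_ge0 (V _) (V _)).
- apply: (le_trans (two _ _ _ _ _ (row_move n4 sr' xr) (col_move (a := s) (b := - s) n1 _ _))) => //.
    by apply/andP; split; lra.
  rewrite addeC /cross_mass; apply: leeD; first by rewrite leeDl.
  by rewrite -[leLHS]add0e leeD2r.
Qed.

Lemma measurable_col_mass : measurable_fun [set: T] col_mass.
Proof.
exact: (@measurable_integral_on _ _ _ T T mu `[- r, r]%classic (fun z => rho (p + z))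
  (measurable_itv _) (measurableT_comp mrho (measurable_translation p)) (fun=> rho0 _)).
Qed.

Lemma measurable_row_mass : measurable_fun [set: T] row_mass.
Proof.
have sw : measurable_fun [set: T * T] (fun z => (z.2, z.1) : T * T).
  exact: (measurable_fun_pair measurable_snd measurable_fst).
exact: (@measurable_integral_on _ _ _ T T mu `[- r, r]%classic (fun z => rho (p + (z.2, z.1)))
  (measurable_itv _)
  (measurableT_comp (measurableT_comp mrho (measurable_translation p)) sw) (fun=> rho0 _)).
Qed.

Lemma sq0E : square (0 : R * R) r = `[- r, r]%classic `*` `[- r, r]%classic.
Proof. by rewrite /square /= !sub0r !add0r. Qed.

Lemma integral_col_mass :
  (\int[mu]_(x in `[(- r)%R, r]) col_mass x = sq_mass rho r p)%E.
Proof.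
rewrite /sq_mass -integral_sq// sq0E.
rewrite (@tonelli_rect _ _ T T R mu mu _ _ (fun z => rho (p + z)))//.
exact: (measurableT_comp mrho (measurable_translation p)).
Qed.

Lemma integral_row_mass :
  (\int[mu]_(x in `[(- r)%R, r]) row_mass x = sq_mass rho r p)%E.
Proof.
rewrite -integral_col_mass /row_mass /col_mass.
rewrite (@tonelli_on _ _ T T R mu mu `[- r, r]%classic `[- r, r]%classic (fun z => rho (p + z)))//.
exact: (measurableT_comp mrho (measurable_translation p)).
Qed.

Lemma integral_itv_reflect (f : T -> \bar R) : measurable_fun [set: T] f ->
  (forall x, 0 <= f x)%E ->
  (\int[mu]_(x in `[(- r)%R, r]) f (- x)%R = \int[mu]_(x in `[(- r)%R, r]) f x)%E.
Proof.
move=> mf f0.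
rewrite -(@integral_reflect _ `[- r, r]%classic f)//; last exact: measurable_funTS.
congr (integral _ _ _); apply/seteqP; split=> x /=; rewrite !in_itv/= => /andP[? ?];
apply/andP; split; lra.
Qed.

Lemma measurable_cross_mass : measurable_fun [set: T] cross_mass.
Proof.
have mV := measurable_col_mass; have mH := measurable_row_mass.
have mo : measurable_fun [set: T] (fun x : T => (- x : T)) by exact: oppr_measurable.
apply: emeasurable_funD; apply: emeasurable_funD => //.
- exact: (measurableT_comp mV mo).
- exact: (measurableT_comp mH mo).
Qed.

Lemma integral_cross_mass :
  (\int[mu]_(x in `[(- r)%R, r]) cross_mass x = 4%:E * sq_mass rho r p)%E.
Proof.
have mV := measurable_col_mass; have mH := measurable_row_mass.
have mo : measurable_fun [set: T] (fun x : T => (- x : T)) by exact: oppr_measurable.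
have mVo := measurableT_comp mV mo; have mHo := measurableT_comp mH mo.
have V := col_mass_ge0; have H := row_mass_ge0.
have mI : measurable (`[- r, r]%classic : set T) by exact: measurable_itv.
have D (f g : T -> \bar R) : (forall x, 0 <= f x)%E -> (forall x, 0 <= g x)%E ->
    measurable_fun [set: T] f -> measurable_fun [set: T] g ->
    (\int[mu]_(x in `[(- r)%R, r]) (f x + g x) =
     \int[mu]_(x in `[(- r)%R, r]) f x + \int[mu]_(x in `[(- r)%R, r]) g x)%E.
  move=> f0 g0 mf mg.
  by rewrite ge0_integralD//; [exact: measurable_funTS mf|exact: measurable_funTS mg].
have VN x : (0 <= col_mass (- x))%E by [].
have HN x : (0 <= row_mass (- x))%E by [].
rewrite (D _ _ (fun x => adde_ge0 (V x) (VN x)) (fun x => adde_ge0 (H x) (HN x))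
  (emeasurable_funD mV mVo) (emeasurable_funD mH mHo)).
rewrite (D _ _ V VN mV mVo) (D _ _ H HN mH mHo).
rewrite !integral_itv_reflect// integral_col_mass integral_row_mass.
by rewrite mule4// sq_mass_ge0.
Qed.

Lemma lebesgue_measure_sym_itv : mu `[- r, r]%classic = (2 * r)%:E.
Proof.
have rr : - r < r by rewrite gtrN.
rewrite lebesgue_measure_itv/= lte_fin rr.
by rewrite -EFinB; congr EFin; ring.
Qed.

Lemma integral_fst_sq (f : T -> \bar R) : measurable_fun [set: T] f ->
  (forall x, 0 <= f x)%E ->
  (\int[m2 R]_(h in square 0%R r) f h.1 =
   (2 * r)%:E * \int[mu]_(x in `[(- r)%R, r]) f x)%E.
Proof.
move=> mf f0; rewrite sq0E.
have mI : measurable (`[- r, r]%classic : set T) by exact: measurable_itv.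
rewrite (@tonelli_rect _ _ T T R mu mu _ _ (fun z => f z.1))//; last first.
  exact: (measurableT_comp mf measurable_fst).
have cE x : (\int[mu]_(y in `[(- r)%R, r]) f x = (2 * r)%:E * f x)%E.
  by rewrite integral_cst// muleC -lebesgue_measure_sym_itv.
under eq_integral do rewrite /= cE.
rewrite ge0_integralZl_EFin//; first exact: measurable_funTS.
by rewrite mulr_ge0// ltW.
Qed.

Lemma integral_snd_sq (f : T -> \bar R) : measurable_fun [set: T] f ->
  (forall x, 0 <= f x)%E ->
  (\int[m2 R]_(h in square 0%R r) f h.2 =
   (2 * r)%:E * \int[mu]_(x in `[(- r)%R, r]) f x)%E.
Proof.
move=> mf f0; rewrite sq0E.
have mI : measurable (`[- r, r]%classic : set T) by exact: measurable_itv.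
rewrite (@tonelli_rect _ _ T T R mu mu _ _ (fun z => f z.2))//; last first.
  exact: (measurableT_comp mf measurable_snd).
by rewrite /= integral_cst// muleC -lebesgue_measure_sym_itv.
Qed.

Variables (uh : R * R -> R) (Bad : set R).
Hypothesis hE1 : mu.-negligible (fst @` E).
Hypothesis hE2 : mu.-negligible (snd @` E).
Hypothesis muh : measurable_fun [set: T * T] uh.
Hypothesis hBad : mu.-negligible Bad.
Hypothesis uhE : forall z, ~ Bad z.2 -> uh z = u z.

(** Almost every square concentric to the one of center p has its boundary on
   lines that miss E; this boundary meets F, and u oscillates on it by at most
   the mass of rho along the four lines. *)
Lemma boundary_average (F : set (R * R)) (k : R) q : connected F -> F p -> F q ->
  r <= `|q - p| -> (forall w, F w -> ~ E w -> u w = k) ->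
  (\int[m2 R]_(h in square 0%R r) `|uh (p + h)%R - k|%:E <=
   4%:E * ((2 * r)%:E * (4%:E * sq_mass rho r p)))%E.
Proof.
move=> cF Fp Fq rq uk.
have mC := measurable_cross_mass; have C0 := cross_mass_ge0.
have mC1 : measurable_fun [set: T * T] (fun h : T * T => cross_mass h.1).
  exact: (measurableT_comp mC measurable_fst).
have mC2 : measurable_fun [set: T * T] (fun h : T * T => cross_mass h.2).
  exact: (measurableT_comp mC measurable_snd).
pose g (h : R * R) := (cross_mass h.1 + cross_mass h.2)%E.
have mg : measurable_fun [set: T * T] g by exact: emeasurable_funD.
have g0 h : (0 <= g h)%E by exact: adde_ge0.
have mS := measurable_sq (0 : R * R) r.
have ig : (\int[m2 R]_(h in square 0%R r) g h =
    (2 * r)%:E * (4%:E * sq_mass rho r p) + (2 * r)%:E * (4%:E * sq_mass rho r p))%E.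
  rewrite /g (ge0_integralD _ mS (fun h _ => C0 h.1) (measurable_funTS mC1)
    (fun h _ => C0 h.2) (measurable_funTS mC2)).
  by rewrite integral_fst_sq// integral_snd_sq// integral_cross_mass.
have ae : {ae m2 R, forall h, square 0 r h -> (`|uh (p + h)%R - k|%:E <= g h + g h)%E}.
  have n1 := negligible_fst (negligible_shift p.1 hE1).
  have n2 := negligible_fst (negligible_reflect p.1 hE1).
  have n3 := negligible_snd (negligible_shift p.1 hE1).
  have n4 := negligible_snd (negligible_reflect p.1 hE1).
  have m1 := negligible_fst (negligible_shift p.2 hE2).
  have m2 := negligible_fst (negligible_reflect p.2 hE2).
  have m3 := negligible_snd (negligible_shift p.2 hE2).
  have m4 := negligible_snd (negligible_reflect p.2 hE2).
  have b := negligible_snd (negligible_shift p.2 hBad).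
  apply: negligibleS (negligibleU (negligibleU (negligibleU (negligibleU n1 n2)
    (negligibleU n3 n4)) (negligibleU (negligibleU m1 m2) (negligibleU m3 m4))) b).
  move=> [x y] /=; apply: contra_notP => /not_orP[/not_orP[/not_orP[
    /not_orP[/= a1 a2] /not_orP[/= a3 a4]] /not_orP[/not_orP[/= c1 c2]
    /not_orP[/= c3 c4]]] /= hb].
  rewrite sq0E => -[/=]; rewrite !in_itv/= => xr yr.
  rewrite uhE//.
  pose s := Num.max `|x| `|y|.
  have sr : s <= r by rewrite /s ge_max !ler_norml xr yr.
  have s0 : 0 <= s by rewrite /s le_max normr_ge0.
  have [n1' n2' n3' n4'] : [/\ ~ (fst @` E) (p.1 + s), ~ (fst @` E) (p.1 - s),
     ~ (snd @` E) (p.2 + s) & ~ (snd @` E) (p.2 - s)].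
    rewrite /s /Num.max; case: ltP => _.
      by have [y0|y0] := ler0P y; rewrite ?opprK.
    by have [y0|y0] := ler0P x; rewrite ?opprK.
  have Cs : (cross_mass s <= g (x, y))%E.
    have [sx|sy] : s = `|x| \/ s = `|y| by rewrite /s /Num.max; case: ltP; [right|left].
      rewrite sx; have -> : cross_mass `|x| = cross_mass x.
        by have [_|_] := ler0P x; rewrite ?cross_massN.
      by rewrite leeDl.
    rewrite sy; have -> : cross_mass `|y| = cross_mass y.
      by have [_|_] := ler0P y; rewrite ?cross_massN.
    by rewrite leeDr.
  have [w Fw ws] := connected_meets_spheres cF Fp Fq rq s0 sr.
  have ws' : Num.max `|w.1 - p.1| `|w.2 - p.2| = s by exact: ws.
  have wE : w = p + (w.1 - p.1, w.2 - p.2).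
    by case: (w) => w1 w2; congr pair => /=; rewrite subrKC.
  have nEw : ~ E w.
    move=> Ew; have [w1|[w1|[w2|w2]]] : w.1 - p.1 = s \/ w.1 - p.1 = - s \/
        w.2 - p.2 = s \/ w.2 - p.2 = - s.
      move: ws'; rewrite /Num.max; case: ltP => _ <-.
        by have [h|h] := ler0P (w.2 - p.2); [right; right; right|right; right; left]; rewrite ?opprK.
      by have [h|h] := ler0P (w.1 - p.1); [right; left|left]; rewrite ?opprK.
    - by apply: n1'; rewrite -w1 subrKC; exists w.
    - by apply: n2'; rewrite -w1 subrKC; exists w.
    - by apply: n3'; rewrite -w2 subrKC; exists w.
    - by apply: n4'; rewrite -w2 subrKC; exists w.
  have H1 := corner_move sr erefl n1' n2' n3' n4' : (_ <= cross_mass s)%E.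
  have H2 := corner_move sr ws' n1' n2' n3' n4'.
  rewrite -wE (uk w Fw nEw) in H2.
  apply: (@le_trans _ _ (cross_mass s + cross_mass s)%E); last exact: leeD.
  apply: le_trans (leeD H1 H2); rewrite -EFinD lee_fin.
  by rewrite [X in _ <= _ + X]distrC ler_distD.
apply: (@le_trans _ _ (\int[m2 R]_(h in square 0%R r) (g h + g h))%E).
  apply: ae_ge0_le_integral => //.
  - apply: measurable_funTS; apply/measurable_EFinP.
    apply: (measurableT_comp (@normr_measurable R setT)).
    apply: measurable_funB => //.
    exact: (measurableT_comp muh (measurable_translation p)).
  - by move=> h _; exact: adde_ge0.
  - by apply: measurable_funTS; exact: emeasurable_funD.
rewrite (ge0_integralD _ mS (fun h _ => g0 h) (measurable_funTS mg)
  (fun h _ => g0 h) (measurable_funTS mg)).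
by rewrite ig mule4// !mule_ge0 ?lee_fin ?mulr_ge0 ?sq_mass_ge0// ltW.
Qed.

End boundary_values.

(** * A measurable representative of the potential *)

Section representative.
Context {R : realType}.
Notation mu := (@lebesgue_measure R).
Notation T := (measurableTypeR R).
Variables (E : set (R * R)) (rho : R * R -> \bar R) (u : R * R -> R).
Hypothesis hE1 : mu.-negligible (fst @` E).
Hypothesis hE2 : mu.-negligible (snd @` E).
Hypothesis mrho : measurable_fun [set: T * T] rho.
Hypothesis rho0 : forall z, (0 <= rho z)%E.
Hypothesis rho2 : (\int[m2 R]_z rho z ^+ 2 < +oo)%E.
Hypothesis urho : line_bounded E rho u.

Lemma sqr_sq_mass_le (p : R * R) (r : R) : 0 < r ->
  (sq_mass rho r p ^+ 2 <= ((2 * r) ^+ 2)%:E * \int[m2 R]_(z in square p r) (rho z ^+ 2))%E.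
Proof.
move=> r0; apply: sqr_integral_le => //.
- exact: measurable_sq.
- exact: measurable_funTS.
- by rewrite exprn_gt0// mulr_gt0.
- exact: (m2_sq p (ltW r0)).
Qed.

(** Square integrability gives local integrability. *)
Lemma sq_mass_fin (p : R * R) (r : R) : (sq_mass rho r p < +oo)%E.
Proof.
have r1 : 0 < `|r| + 1 by rewrite ltr_pwDr.
have sub : square p r `<=` square p (`|r| + 1).
  by apply: sq_sub; rewrite subrr normr0; have := ler_norm r; lra.
apply: (le_lt_trans (integral_sq_le mrho rho0 sub)); rewrite -/(sq_mass _ _ _).
have := sqr_sq_mass_le p r1.
have : (\int[m2 R]_(z in square p (`|r| + 1)) (rho z ^+ 2) < +oo)%E.
  apply: le_lt_trans rho2; apply: ge0_subset_integral => //.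
  - exact: measurable_sq.
  - exact: measurable_sqre.
  - by move=> z _; exact: sqre_ge0.
have := sq_mass_ge0 (`|r| + 1) p rho0.
case: (sq_mass rho (`|r| + 1) p) => [m _|_|//]; first by rewrite ltry.
rewrite expe2 mulyy => fin; rewrite leye_eq => /eqP Eoo; move: fin.
have I0 : (0 <= \int[m2 R]_(z in square p (`|r| + 1)) (rho z ^+ 2))%E.
  by apply: integral_ge0 => z _; exact: sqre_ge0.
rewrite -ge0_fin_numE// => fin.
by have : (+oo : \bar R)%E \is a fin_num by rewrite -Eoo fin_numM.
Qed.

(** The potential is an infimum over uncountably many curves; its
   measurability comes from its continuity along almost every line. *)
Lemma good_representative : exists (uh : R * R -> R) (Bad : set R),
  [/\ measurable_fun [set: T * T] uh, mu.-negligible Bad,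
      (forall z, ~ Bad z.2 -> uh z = u z) &
      forall z, uh z = u z \/ uh z = 0].
Proof.
have fin (n : nat) : (\int[mu]_(x in `[(- n%:R)%R, n%:R%R])
    \int[mu]_(y in `[(- n%:R)%R, n%:R%R]) rho (x, y) < +oo)%E.
  have := sq_mass_fin 0 n%:R.
  rewrite /sq_mass /square /= sub0r add0r.
  by rewrite (@tonelli_rect _ _ T T R mu mu _ _ rho).
have msw : measurable_fun [set: T * T] (fun z : T * T => (z.2, z.1) : T * T).
  exact: (measurable_fun_pair measurable_snd measurable_fst).
pose rho' (z : R * R) := rho (z.2, z.1).
have mrho' : measurable_fun [set: T * T] rho' by exact: (measurableT_comp mrho msw).
have fin' (n : nat) : (\int[mu]_(x in `[(- n%:R)%R, n%:R%R])
    \int[mu]_(y in `[(- n%:R)%R, n%:R%R]) rho' (x, y) < +oo)%E.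
  apply: le_lt_trans (fin n); rewrite le_eqVlt; apply/orP; left; apply/eqP.
  exact: (@tonelli_on _ _ T T R mu mu `[- n%:R, n%:R]%classic `[- n%:R, n%:R]%classic rho'
    (measurable_itv _) (measurable_itv _) mrho' (fun z => rho0 (z.2, z.1))).
have [A [mA A0 AE Afin]] := good_lines hE1 mrho rho0 fin.
have [B [mB B0 BE Bfin]] := good_lines hE2 mrho' (fun z => rho0 (z.2, z.1)) fin'.
have mu_ : measurable_fun ([set: T] `*` B) u.
  apply: (@separately_continuous_measurable _ u A B) => //.
    move=> x Ax; apply: (bounded_increment_continuous (q := fun t => rho (x, t))) => //.
    + exact: measurable_column.
    + exact: Afin.
    + move=> a b ab.
      have rE t : ray (x, 0) (0, 1) t = (x, t) by rewrite /ray /= mulr0 mulr1 addr0 add0r.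
      have := @urho (x, 0) (0, 1) a b; rewrite /= expr0n expr1n add0r !rE.
      under eq_integral do rewrite rE.
      by apply=> // t _; rewrite rE => Et; apply: (AE _ Ax); exists (x, t).
  move=> y By; apply: (bounded_increment_continuous (q := fun t => rho (t, y))) => //.
  + exact: (measurable_column y mrho').
  + exact: (Bfin y By).
  + move=> a b ab.
    have rE t : ray (0, y) (1, 0) t = (t, y) by rewrite /ray /= mulr0 mulr1 addr0 add0r.
    have := @urho (0, y) (1, 0) a b; rewrite /= expr0n expr1n addr0 !rE.
    under eq_integral do rewrite rE.
    by apply=> // t _; rewrite rE => Et; apply: (BE _ By); exists (t, y).
have mD : measurable ([set: T] `*` B) by exact: measurableX.
exists (u \_ ([set: T] `*` B)), (~` B); split.
- exact: ((measurable_restrictT u mD).1 mu_).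
- by exists (~` B); split => //; exact: measurableC.
- move=> z /contrapT Bz; rewrite patchE ifT//; apply/mem_set; exact: (conj I Bz).
- by move=> z; rewrite patchE; case: ifP => _; [left|right].
Qed.

End representative.

(** * Modulus between nondegenerate continua *)

Section modulus_bound.
Context {R : realType}.
Notation mu := (@lebesgue_measure R).
Notation T := (measurableTypeR R).
Implicit Types (p q z : R * R) (F : set (R * R)).

(** This fixes a scale below which every square centered on F has a boundary
   that F crosses. *)
Lemma far_point F a b : F a -> F b -> forall p,
  exists2 q, F q & `|b - a| / 2 <= `|q - p|.
Proof.
move=> Fa Fb p.
have : `|b - a| <= `|b - p| + `|a - p| by rewrite [`|a - p|]distrC; exact: ler_distD.
have [h|h] := leP (`|b - a| / 2) `|b - p|; first by exists b.
by move=> H; exists a => //; lra.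
Qed.

Lemma sixth_power_le (t : R) : 0 <= t -> t <= 1 -> (1 + t) ^+ 6 <= 1 + 63 * t.
Proof.
move=> t0 t1.
have t2 : t ^+ 2 <= t by rewrite expr2 ler_piMl.
have e2 : (1 + t) ^+ 2 <= 1 + 3 * t by rewrite sqrrD expr1n; lra.
have p2 : 0 <= (1 + t) ^+ 2 by rewrite sqr_ge0.
have e4 : (1 + t) ^+ 2 * (1 + t) ^+ 2 <= (1 + 3 * t) * (1 + 3 * t) by apply: ler_pM.
have e4' : (1 + 3 * t) * (1 + 3 * t) <= 1 + 15 * t by nra.
have -> : (1 + t) ^+ 6 = (1 + t) ^+ 2 * (1 + t) ^+ 2 * (1 + t) ^+ 2 by ring.
have e6 : (1 + t) ^+ 2 * (1 + t) ^+ 2 * (1 + t) ^+ 2 <= (1 + 15 * t) * (1 + 3 * t).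
  by apply: ler_pM => //; [exact: mulr_ge0|exact: le_trans e4 e4'].
by apply: le_trans e6 _; nra.
Qed.

Variables (E F1 F2 : set (R * R)) (rho : R * R -> \bar R).
Hypothesis hE1 : mu.-negligible (fst @` E).
Hypothesis hE2 : mu.-negligible (snd @` E).
Hypothesis adm : admissible (joining F1 F2 `&` avoiding E) rho.
Hypothesis rho2 : (\int[m2 R]_z rho z ^+ 2 < +oo)%E.
Hypothesis cF1 : connected F1.
Hypothesis cF2 : connected F2.

(** With U the average over squares of half-side r of the potential of rho,
   U is small on F1 and close to the area of the square on F2, and the mass of
   rho_N on slightly larger squares is an upper gradient of U. Dividing it by
   the increment of U gives a function that is admissible for all curves. *)
Lemma joining_modulus_le (N : set (R * R)) s (a1 b1 a2 b2 : R * R) (e : R) :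
  F1 a1 -> F1 b1 -> a1 != b1 -> F2 a2 -> F2 b2 -> a2 != b2 ->
  measurable (N : set (T * T)) -> 0 < s ->
  (forall z x, E x -> `|z.1 - x.1| <= 3 * s -> `|z.2 - x.2| <= 3 * s -> N z) ->
  0 < e ->
  (Mod2 (joining F1 F2) <=
   (1 + e)%:E * \int[m2 R]_z ((rho z + 2%:E * (rho \_ N) z) ^+ 2))%E.
Proof.
move=> Fa1 Fb1 ab1 Fa2 Fb2 ab2 mN s0 EN e0.
have [mrho rho0 _] := adm.
pose u := potential E F1 rho.
have urho : line_bounded E rho u by exact: potential_line_bounded.
have ub z : 0 <= u z <= 1 by have [-> -> _] := potential_bounds E F1 rho0 z.
have u1 w : F1 w -> ~ E w -> u w = 0 by exact: potential_source.
have u2 w : F2 w -> ~ E w -> u w = 1 by move=> Fw _; exact: potential_target adm Fw.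
have [uh [Bad [muh hBad uhE uh01]]] := good_representative hE1 hE2 mrho rho0 rho2 urho.
have uhb z : 0 <= uh z <= 1 by case: (uh01 z) => ->; rewrite ?ub// lexx ler01.
have uh0 z : 0 <= uh z by case/andP: (uhb z).
(* th controls all the errors; (1 + th) ^ 6 <= 1 + e *)
pose th := Num.min 1 (e / 63).
have th0 : 0 < th by rewrite /th lt_min ltr01 divr_gt0.
have th6 : (1 + th) ^+ 6 <= 1 + e.
  apply: (le_trans (sixth_power_le (ltW th0) _)); first by rewrite /th ge_min lexx.
  have : th <= e / 63 by rewrite /th ge_min lexx orbT.
  by lra.
pose ka := th / (32 * (1 + th)).
have th1 : 0 < 1 + th by rewrite addr_gt0.
have ka0 : 0 < ka by rewrite divr_gt0// mulr_gt0.
have mr2 : measurable_fun [set: T * T] (fun z => rho z ^+ 2)%E by exact: measurable_sqre.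
have r20 z : (0 <= rho z ^+ 2)%E by exact: sqre_ge0.
have [del del0 Hdel] := integral_absolutely_continuous mr2 r20 rho2 (exprn_gt0 2 ka0).
have D1 : 0 < `|b1 - a1| / 2 by rewrite divr_gt0// normr_gt0 subr_eq0 eq_sym.
have D2 : 0 < `|b2 - a2| / 2 by rewrite divr_gt0// normr_gt0 subr_eq0 eq_sym.
pose r := Num.min (Num.min (`|b1 - a1| / 2) (`|b2 - a2| / 2)) (Num.min 1 (del / 5)).
have r0 : 0 < r by rewrite /r !lt_min D1 D2 ltr01 divr_gt0.
have rD1 : r <= `|b1 - a1| / 2 by rewrite /r !ge_min lexx.
have rD2 : r <= `|b2 - a2| / 2 by rewrite /r !ge_min lexx !orbT.
have r1 : r <= 1 by rewrite /r !ge_min lexx !orbT.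
have rdel : r <= del / 5 by rewrite /r !ge_min lexx !orbT.
pose c := (2 * r) ^+ 2.
have c0 : 0 < c by rewrite exprn_gt0// mulr_gt0.
have cdel : c < del by rewrite /c; nra.
have mass p : (sq_mass rho r p <= (2 * r * ka)%:E)%E.
  have I2 : (\int[m2 R]_(z in square p r) (rho z ^+ 2) <= (ka ^+ 2)%:E)%E.
    apply: Hdel; first exact: measurable_sq.
    suff : (m2 R (square p r) < del%:E)%E by [].
    by rewrite m2_sq ?lte_fin// ltW.
  have := sq_mass_fin mrho rho0 rho2 p r; have := sq_mass_ge0 r p rho0.
  have := sqr_sq_mass_le mrho rho0 p r0.
  have H2 : (c%:E * \int[m2 R]_(z in square p r) (rho z ^+ 2) <= c%:E * (ka ^+ 2)%:E)%E.
    by apply: lee_wpmul2l => //; rewrite lee_fin ltW.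
  move=> /le_trans /(_ H2); case: (sq_mass rho r p) => [m| |]//.
  rewrite -EFin_expe -EFinM !lee_fin => le2 m0 _.
  have rk0 : 0 <= 2 * r * ka by rewrite mulr_ge0 ?(ltW ka0)// mulr_ge0// ltW.
  rewrite -ler_sqr ?nnegrE//.
  by apply: le_trans le2 _; rewrite /c [leRHS]exprMn.
have dev (F : set (R * R)) (k : R) a b p : connected F -> F a -> F b -> F p ->
    r <= `|b - a| / 2 -> (forall w, F w -> ~ E w -> u w = k) ->
    (\int[m2 R]_(h in square 0%R r) `|uh (p + h)%R - k|%:E <= (c * (16 * ka))%:E)%E.
  move=> cF Fa Fb Fp rab uk.
  have [q Fq pq] := far_point Fa Fb p.
  apply: (le_trans (boundary_average mrho rho0 urho r0 hE1 hE2 muh hBad uhE cF Fp Fq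
    (le_trans rab pq) uk)).
  have -> : (c * (16 * ka))%:E = (4%:E * ((2 * r)%:E * (4%:E * (2 * r * ka)%:E)))%E.
    by rewrite -!EFinM; congr EFin; rewrite /c; ring.
  by do 3! (apply: lee_wpmul2l; first by rewrite lee_fin ?mulr_ge0// ltW).
have muhp p : measurable_fun [set: T * T] (fun h => (uh (p + h)%R)%:E).
  exact: measurable_uh_shift.
have mS := measurable_sq (0 : R * R) r.
have S1 : (\int[m2 R]_(h in square 0%R r) 1 = c%:E)%E.
  rewrite integral_cst// mul1e; exact: (m2_sq 0 (ltW r0)).
have avg0 p : (0 <= sq_avg uh r p)%E.
  by apply: integral_ge0 => h _; rewrite lee_fin.
have avgc p : (sq_avg uh r p <= c%:E)%E.
  rewrite -S1; apply: ge0_le_integral => //.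
  - by move=> h _; rewrite lee_fin.
  - exact: measurable_funTS (muhp p).
  - by move=> h _; rewrite lee_fin; case/andP: (uhb (p + h)).
have avgfin p : sq_avg uh r p \is a fin_num.
  by rewrite ge0_fin_numE// (le_lt_trans (avgc p))// ltry.
pose Phi p := fine (sq_avg uh r p).
have PhiE p : (Phi p)%:E = sq_avg uh r p by rewrite /Phi fineK.
have Phi1 p : F1 p -> Phi p <= c * (16 * ka).
  move=> Fp; rewrite -lee_fin PhiE; apply: le_trans (dev F1 0 _ _ p cF1 Fa1 Fb1 Fp rD1 u1).
  rewrite le_eqVlt; apply/orP; left; apply/eqP; apply: eq_integral => h _.
  by rewrite subr0 ger0_norm.
have Phi2 p : F2 p -> c - c * (16 * ka) <= Phi p.
  move=> Fp; rewrite lerBlDr -lee_fin EFinD PhiE.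
  apply: (le_trans _ (leeD (lexx _) (dev F2 1 _ _ p cF2 Fa2 Fb2 Fp rD2 u2))).
  rewrite -S1 /sq_avg -ge0_integralD//; last 3 first.
  - by move=> h _; rewrite lee_fin.
  - exact: measurable_funTS (muhp p).
  - apply: measurable_funTS; apply/measurable_EFinP.
    apply: (measurableT_comp (@normr_measurable R setT)).
    apply: measurable_funB => //.
    exact: (measurableT_comp muh (measurable_translation p)).
  apply: ge0_le_integral => //.
  - apply: emeasurable_funD; first exact: measurable_funTS (muhp p).
    apply: measurable_funTS; apply/measurable_EFinP.
    apply: (measurableT_comp (@normr_measurable R setT)).
    apply: measurable_funB => //.
    exact: (measurableT_comp muh (measurable_translation p)).
  - move=> h _; rewrite -EFinD lee_fin.
    by have := ler_norm (1 - uh (p + h)); rewrite distrC; lra.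
pose s' := Num.min s (th * r / 2).
have s'0 : 0 < s' by rewrite /s' lt_min s0 divr_gt0// mulr_gt0.
have s's : s' <= s by rewrite /s' ge_min lexx.
have s'r : r + 2 * s' <= r * (1 + th).
  have : s' <= th * r / 2 by rewrite /s' ge_min lexx orbT.
  by lra.
have EN' z x : E x -> `|z.1 - x.1| <= 3 * s' -> `|z.2 - x.2| <= 3 * s' -> N z.
  by move=> Ex h1 h2; apply: (EN z x Ex); lra.
pose rhoN z := (rho z + 2%:E * (rho \_ N) z)%E.
have mrN : measurable_fun [set: T * T] (rho \_ N) := measurable_rhoN mrho mN.
have rN0 := patch_ge0 N rho0.
have mrhoN : measurable_fun [set: T * T] rhoN.
  by apply: emeasurable_funD => //; exact: measurable_funeM.
have rhoN0 z : (0 <= rhoN z)%E by rewrite adde_ge0// mule_ge0.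
pose r' := r + 2 * s'.
have r'0 : 0 < r' by rewrite addr_gt0// mulr_gt0.
pose G := sq_mass rhoN r'.
have mG : measurable_fun [set: T * T] G by exact: measurable_sq_mass.
have G0 z : (0 <= G z)%E by exact: sq_mass_ge0.
have step p q z : euclidean_dist p q <= s' -> euclidean_dist p z <= s' ->
    ((Phi q)%:E <= (Phi p)%:E + (euclidean_dist p q)%:E * G z)%E.
  move=> pq pz; rewrite !PhiE.
  exact: (sq_avg_step hE1 hE2 mrho rho0 urho muh uh0 hBad uhE mN r0 EN' pq pz).
pose K := c^-1 * (1 + th).
have K0 : 0 < K by rewrite mulr_gt0// invr_gt0.
have K1 : K * (c - c * (32 * ka)) = 1.
  rewrite /K /ka; field; apply/andP; split; exact: lt0r_neq0.
apply: (@le_trans _ _ (\int[m2 R]_z ((K%:E * G z) ^+ 2))%E).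
  apply: ereal_inf_lbound; exists (fun z => K%:E * G z)%E => //; split.
  - exact: measurable_funeM.
  - by move=> z; rewrite mule_ge0// lee_fin ltW.
  move=> g [Fs Fe] rg; rewrite /line_integral.
  set l := fine (curve_length g); have l0 : 0 <= l := fine_curve_length_ge0 g.
  have sm : short_map (arclength_param g) l.
    by move=> x y; rewrite !in_itv/=; exact: arclength_param_lipschitz.
  have mGg := short_map_measurable l0 sm mG.
  have := increment_along_short_map mG G0 s'0 step l0 sm.
  rewrite arclength_param_length// arclength_param0// => H.
  rewrite (_ : (\int[_]_(_ in _) _)%E =
     (K%:E * \int[mu]_(t in `[0%R, l]) G (arclength_param g t))%E); last first.
    by rewrite ge0_integralZl_EFin//; exact: ltW.
  rewrite -K1 EFinM; apply: lee_wpmul2l; first by rewrite lee_fin ltW.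
  have := le_trans (_ : (c - c * (16 * ka))%:E <= (Phi (curve_end g))%:E)%E H.
  rewrite lee_fin => /(_ (Phi2 _ Fe)).
  have := Phi1 _ Fs; case: (integral _ _ _) => [I|_ _|_].
  - by rewrite -EFinD !lee_fin; lra.
  - by rewrite leey.
  - by rewrite addeNy.
rewrite (_ : (\int[_]_(_ in _) _)%E = ((K ^+ 2)%:E * \int[m2 R]_z (G z ^+ 2))%E); last first.
  rewrite -ge0_integralZl_EFin//; last 3 first.
  - by move=> z _; exact: sqre_ge0.
  - exact: measurable_sqre.
  - exact: sqr_ge0.
  by apply: eq_integral => z _; rewrite !expe2 EFinM muleACA.
apply: (le_trans (lee_wpmul2l _ (sqr_sq_mass_integral r'0 mrhoN rhoN0))).
  by rewrite lee_fin sqr_ge0.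
rewrite muleA -EFinM; apply: lee_wpmul2r.
  by apply: integral_ge0 => z _; exact: sqre_ge0.
rewrite lee_fin; apply: le_trans th6.
have -> : (1 + th) ^+ 6 = ((1 + th) ^+ 3) ^+ 2 by rewrite -exprM.
rewrite -exprMn; apply: lerXn2r; rewrite ?nnegrE.
- by rewrite mulr_ge0 ?sqr_ge0// ltW.
- by rewrite exprn_ge0// ltW.
rewrite /K -mulrA mulrC -mulrA.
have -> : (1 + th) ^+ 3 = (1 + th) * (1 + th) ^+ 2 by rewrite exprS.
rewrite ler_pM2l// ler_pdivrMr// /c -exprMn.
apply: lerXn2r; rewrite ?nnegrE.
- by rewrite mulr_ge0// ltW.
- by rewrite mulr_ge0 ?(ltW th1)// mulr_ge0// ltW.
by have := s'r; rewrite -/r'; lra.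
Qed.

End modulus_bound.

(** * Curves through a point *)

Section curves_at_a_point.
Context {R : realType}.
Notation mu := (@lebesgue_measure R).
Notation T := (measurableTypeR R).
Implicit Types (p q z : R * R) (G : set (curve R)).

Lemma Mod2_ge0 G : (0 <= Mod2 G)%E.
Proof.
apply: le_ereal_inf_tmp => _ [rho _ <-]; apply: integral_ge0 => z _.
exact: sqre_ge0.
Qed.

Lemma le_Mod2 G G' : G `<=` G' -> (Mod2 G <= Mod2 G')%E.
Proof.
move=> GG'; apply: le_ereal_inf => _ [rho [mrho rho0 adm] <-].
by exists rho => //; split => // g /GG'; exact: adm.
Qed.

Variables (p : R * R) (d : R).
Hypothesis d0 : 0 < d.

Definition dyadic_sq k := square p (d / 2 ^+ k).
Definition dyadic_height k : R := 2 ^+ k / d.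
Definition dyadic_sum n z : R := \sum_(k < n) dyadic_height k * \1_(dyadic_sq k) z.
Definition dyadic_sqsum n z : R := \sum_(k < n) dyadic_height k ^+ 2 * \1_(dyadic_sq k) z.

Lemma dyadic_height_gt0 k : 0 < dyadic_height k.
Proof. by rewrite divr_gt0// exprn_gt0. Qed.

Lemma dyadic_sum_ge0 n z : 0 <= dyadic_sum n z.
Proof. by apply: sumr_ge0 => k _; rewrite mulr_ge0// ltW// dyadic_height_gt0. Qed.

Lemma dyadic_sqsum_ge0 n z : 0 <= dyadic_sqsum n z.
Proof. by apply: sumr_ge0 => k _; rewrite mulr_ge0// sqr_ge0. Qed.

Lemma dyadic_sum_le n z : dyadic_sum n z <= dyadic_height n.
Proof.
elim: n => [|n IH]; first by rewrite /dyadic_sum big_ord0 ltW// dyadic_height_gt0.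
rewrite /dyadic_sum big_ord_recr/= -/(dyadic_sum n z).
have -> : dyadic_height n.+1 = dyadic_height n + dyadic_height n.
  by rewrite /dyadic_height exprS mulr2n !mulrDl mul1r.
by apply: lerD => //; rewrite ler_piMr ?(ltW (dyadic_height_gt0 _))// indicE.
Qed.

(** The heights grow geometrically, so the largest one at a point dominates. *)
Lemma sqr_dyadic_sum_le n z : dyadic_sum n z ^+ 2 <= 4 * dyadic_sqsum n z.
Proof.
elim: n => [|n IH]; first by rewrite /dyadic_sum /dyadic_sqsum !big_ord0 expr0n mulr0.
rewrite /dyadic_sum /dyadic_sqsum !big_ord_recr/= -/(dyadic_sum n z) -/(dyadic_sqsum n z).
have h1 := dyadic_sum_le n z; have h0 := dyadic_sum_ge0 n z.
rewrite indicE; case: (_ \in _) => /=; rewrite ?mulr0 ?addr0// !mulr1.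
by nra.
Qed.

Lemma measurable_dyadic (f : nat -> R) n : measurable_fun [set: T * T]
  (fun z => \sum_(k < n) f k * \1_(dyadic_sq k) z : R).
Proof.
apply: measurable_sum => k; apply: measurable_funM => //.
by apply: measurable_indic; exact: measurable_sq.
Qed.

Lemma measurable_dyadic_sum n :
  measurable_fun [set: T * T] (fun z => (dyadic_sum n z)%:E).
Proof. by apply/measurable_EFinP; exact: (measurable_dyadic dyadic_height n). Qed.

Lemma measurable_dyadic_sqsum n :
  measurable_fun [set: T * T] (fun z => (dyadic_sqsum n z)%:E).
Proof.
apply/measurable_EFinP.
exact: (measurable_dyadic (fun k => dyadic_height k ^+ 2) n).
Qed.

Lemma integral_dyadic_sqsum n :
  (\int[m2 R]_z (dyadic_sqsum n z)%:E = (4 * n%:R)%:E)%E.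
Proof.
elim: n => [|n IH].
  rewrite mulr0; under eq_integral do rewrite /dyadic_sqsum big_ord0.
  by rewrite integral0.
under eq_integral do rewrite /dyadic_sqsum big_ord_recr/= -/(dyadic_sqsum n _) EFinD.
rewrite ge0_integralD//=; last 4 first.
- by move=> z _; rewrite lee_fin dyadic_sqsum_ge0.
- exact: measurable_dyadic_sqsum.
- by move=> z _; rewrite lee_fin mulr_ge0// sqr_ge0.
- apply/measurable_EFinP; apply: measurable_funM => //.
  by apply: measurable_indic; exact: measurable_sq.
rewrite IH; under eq_integral do rewrite EFinM.
rewrite ge0_integralZl_EFin//; last 2 first.
- by apply/measurable_EFinP; apply: measurable_indic; exact: measurable_sq.
- exact: sqr_ge0.
rewrite integral_indic//; last exact: measurable_sq.
rewrite setIT.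
have mE : (m2 R (dyadic_sq n) = ((2 * (d / 2 ^+ n)) ^+ 2)%:E)%E.
  by apply: m2_sq; rewrite divr_ge0 ?exprn_ge0// ltW.
rewrite [X in (_ + _ * X)%E]mE.
rewrite -EFinM -EFinD; congr EFin; rewrite -natr1 /dyadic_height.
have dn : d != 0 by rewrite gt_eqF.
have pn : 2 ^+ n != 0 :> R by rewrite expf_neq0.
by field; apply/andP; split.
Qed.

(** The piece of length d / 2 ^+ k of the curve next to p stays in dyadic_sq k
   and contributes 1. *)
Lemma line_integral_dyadic_sum (g : curve R) n : rectifiable g ->
  d <= fine (curve_length g) -> curve_start g = p \/ curve_end g = p ->
  (n%:R%:E <= line_integral (fun z => (dyadic_sum n z)%:E) g)%E.
Proof.
move=> rg dl ends; rewrite /line_integral.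
set l := fine (curve_length g) in dl *.
have l0 : 0 <= l := fine_curve_length_ge0 g.
have sm : short_map (arclength_param g) l.
  by move=> x y; rewrite !in_itv/=; exact: arclength_param_lipschitz.
have mI : measurable (`[0, l]%classic : set T) by exact: measurable_itv.
have mind k : measurable_fun [set: T * T] (fun z => (dyadic_height k * \1_(dyadic_sq k) z)%:E).
  apply/measurable_EFinP; apply: measurable_funM => //.
  by apply: measurable_indic; exact: measurable_sq.
elim: n => [|n IH].
  by apply: integral_ge0 => s _; rewrite lee_fin dyadic_sum_ge0.
under eq_integral do rewrite /dyadic_sum big_ord_recr/= -/(dyadic_sum n _) EFinD.
rewrite ge0_integralD//=; last 4 first.
- by move=> s _; rewrite lee_fin dyadic_sum_ge0.
- exact: (short_map_measurable l0 sm (measurable_dyadic_sum n)).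
- by move=> s _; rewrite lee_fin mulr_ge0// ltW// dyadic_height_gt0.
- exact: (short_map_measurable l0 sm (mind n)).
rewrite -natr1 EFinD; apply: leeD => //.
pose a := d / 2 ^+ n.
have a0 : 0 <= a by rewrite divr_ge0 ?exprn_ge0// ltW.
have ad : a <= d.
  by rewrite ler_pdivrMr ?exprn_gt0// ler_peMr ?(ltW d0)// exprn_ege1// ler1n.
have inS s : 0 <= s <= l -> euclidean_dist (arclength_param g s) p <= a ->
    dyadic_sq n (arclength_param g s).
  by move=> _ h; apply/sqP; split; apply: le_trans h; [exact: edist_fst|exact: edist_snd].
have part (b : R) : 0 <= b -> b + a <= l ->
    (forall s, s \in `[b, b + a] -> euclidean_dist (arclength_param g s) p <= a) ->
    (1%:E <= \int[mu]_(s in `[0%R, l])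
       (dyadic_height n * \1_(dyadic_sq n) (arclength_param g s))%:E)%E.
  move=> b0 bal close.
  have sub : `[b, b + a]%classic `<=` (`[0, l]%classic : set T).
    by move=> x /=; rewrite !in_itv/= => /andP[? ?]; apply/andP; split; lra.
  apply: (@le_trans _ _ (\int[mu]_(s in `[b, (b + a)%R])
       (dyadic_height n * \1_(dyadic_sq n) (arclength_param g s))%:E)%E); last first.
    apply: ge0_subset_integral => //.
    - exact: (short_map_measurable l0 sm (mind n)).
    - by move=> s _; rewrite lee_fin mulr_ge0// ltW// dyadic_height_gt0.
  rewrite (_ : (\int[_]_(_ in _) _)%E = (\int[mu]_(s in `[b, (b + a)%R]) (dyadic_height n)%:E)%E).
    rewrite integral_cst; last exact: measurable_itv.
    have -> : (1%:E = (dyadic_height n)%:E * a%:E :> \bar R)%E.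
      have dn : d != 0 by rewrite gt_eqF.
      have pn : 2 ^+ n != 0 :> R by rewrite expf_neq0.
      by rewrite -EFinM /dyadic_height /a; congr EFin; field; apply/andP; split.
    apply: lee_wpmul2l; first by rewrite lee_fin ltW// dyadic_height_gt0.
    suff : (a%:E <= mu `[b, (b + a)%R]%classic)%E by [].
    rewrite lebesgue_measure_itv/= lte_fin ltrDl; case: ltP => [_|a_le0]; last by rewrite lee_fin.
    by rewrite -EFinB lee_fin; lra.
  apply: eq_integral => s /set_mem /= sb; congr EFin.
  rewrite indicE mem_set ?mulr1//; apply: inS; last exact: close.
  by have := sub s sb; rewrite /= in_itv.
case: ends => Ep.
  apply: (part 0) => //; first by rewrite add0r (le_trans ad).
  move=> s; rewrite add0r in_itv/= => /andP[s0 sa].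
  rewrite -Ep -(arclength_param0 rg) (le_trans (arclength_param_lipschitz rg _ _))//.
  - by rewrite s0 (le_trans sa)// (le_trans ad).
  - by rewrite lexx.
  - by rewrite subr0 ger0_norm.
apply: (part (l - a)).
- by rewrite subr_ge0 (le_trans ad).
- by rewrite subrK.
move=> s; rewrite subrK in_itv/= => /andP[sa sl].
rewrite -Ep -(arclength_param_length rg) (le_trans (arclength_param_lipschitz rg _ _))//.
- by rewrite sl andbT (le_trans _ sa)// subr_ge0 (le_trans ad).
- by rewrite lexx l0.
- by rewrite -/l distrC ger0_norm ?subr_ge0//; lra.
Qed.

(** The average of the first n functions dyadic_height k * \1_(dyadic_sq k) is
   admissible, since a curve that starts or ends at p spends length d / 2 ^+ k
   in each square; its energy is at most 16 / n because the squares of the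
   terms have equal integrals and their sum dominates the cross terms. *)
Lemma Mod2_through_point G :
  (forall g, G g -> rectifiable g -> d <= fine (curve_length g) /\
     (curve_start g = p \/ curve_end g = p)) ->
  Mod2 G = 0%E.
Proof.
move=> HG; apply/eqP; rewrite eq_le Mod2_ge0 andbT.
have bound (n : nat) : (0 < n)%N -> (Mod2 G <= (16 / n%:R)%:E)%E.
  move=> n0; have nr : 0 < n%:R :> R by rewrite ltr0n.
  have mdy : measurable_fun [set: T * T] (fun z => (dyadic_sum n z)%:E).
    exact: measurable_dyadic_sum.
  apply: (@le_trans _ _ (\int[m2 R]_z ((n%:R^-1%:E * (dyadic_sum n z)%:E) ^+ 2))%E).
    apply: ereal_inf_lbound; exists (fun z => n%:R^-1%:E * (dyadic_sum n z)%:E)%E => //.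
    split.
    - exact: measurable_funeM.
    - by move=> z; rewrite -EFinM lee_fin mulr_ge0 ?dyadic_sum_ge0// invr_ge0.
    move=> g Gg rg; have [dl ends] := HG _ Gg rg.
    have := line_integral_dyadic_sum n rg dl ends; rewrite /line_integral.
    have sm : short_map (arclength_param g) (fine (curve_length g)).
      by move=> x y; rewrite !in_itv/=; exact: arclength_param_lipschitz.
    rewrite ge0_integralZl_EFin//; last 2 first.
    - by move=> s _; rewrite lee_fin dyadic_sum_ge0.
    - exact: (short_map_measurable (fine_curve_length_ge0 g) sm mdy).
    move=> H; have -> : (1 = n%:R^-1%:E * n%:R%:E :> \bar R)%E.
      by rewrite -EFinM mulVf// gt_eqF.
    by apply: lee_wpmul2l => //; rewrite lee_fin invr_ge0.
  apply: (@le_trans _ _ (\int[m2 R]_z ((n%:R^-1 ^+ 2 * 4)%:E * (dyadic_sqsum n z)%:E))%E).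
    apply: ge0_le_integral => //.
    - by move=> z _; exact: sqre_ge0.
    - by apply: measurable_sqre; exact: measurable_funeM.
    - by apply: measurable_funeM; exact: measurable_dyadic_sqsum.
    - move=> z _; rewrite -!EFinM -EFin_expe lee_fin exprMn -[leRHS]mulrA.
      by rewrite ler_wpM2l ?sqr_ge0// sqr_dyadic_sum_le.
  rewrite ge0_integralZl_EFin//; last 2 first.
  - by move=> z _; rewrite lee_fin dyadic_sqsum_ge0.
  - exact: measurable_dyadic_sqsum.
  rewrite integral_dyadic_sqsum -EFinM lee_fin le_eqVlt; apply/orP; left; apply/eqP.
  by field; rewrite gt_eqF.
apply/lee_addgt0Pr => e e0; rewrite add0e.
have := truncnS_gt (16 / e); set n := (Num.truncn _).+1 => ne.
apply: (le_trans (bound n _)) => //; rewrite lee_fin ler_pdivrMr ?ltr0n//.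
by rewrite mulrC -ler_pdivrMr// ltW.
Qed.

End curves_at_a_point.

(** * Neighbourhoods of the exceptional set *)

Section neighbourhoods.
Context {R : realType}.
Notation T := (measurableTypeR R).
Implicit Types (z x : R * R) (A E : set (R * R)).

(** An open set is the union of the countably many grid squares it contains. *)
Lemma open_plane_measurable A :
  (forall z, A z -> exists2 e : R, 0 < e & square z e `<=` A) ->
  measurable (A : set (T * T)).
Proof.
move=> Aop.
pose center (c : nat * int * int) : R * R := (c.1.2%:~R / c.1.1.+1%:R, c.2%:~R / c.1.1.+1%:R).
pose cell c := square (center c) c.1.1.+1%:R^-1.
pose inside c := cell c `<=` A.
have -> : A = \bigcup_(c in inside) cell c.
  apply/seteqP; split=> [z Az|z [c cA]]; last exact: cA.
  have [e e0 zA] := Aop z Az.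
  pose n := Num.truncn (2 / e).
  have ne : n.+1%:R^-1 * 2 <= e.
    by rewrite mulrC ler_pdivrMr// mulrC -ler_pdivrMr// ltW// truncnS_gt.
  have near (t : R) : `|t - (Num.floor (t * n.+1%:R))%:~R / n.+1%:R| <= n.+1%:R^-1.
    have /andP[h1 h2] := floor_itv (t * n.+1%:R); rewrite intrD in h2.
    have n0 : 0 < n.+1%:R :> R by [].
    have g1 : (Num.floor (t * n.+1%:R))%:~R / n.+1%:R <= t by rewrite ler_pdivrMr.
    have g2 : t <= ((Num.floor (t * n.+1%:R))%:~R + 1) / n.+1%:R.
      by rewrite ler_pdivlMr// ltW.
    have aux (q v : R) : q <= t -> t <= q + v -> `|t - q| <= v.
      by move=> ? ?; rewrite ger0_norm ?subr_ge0// lerBlDl.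
    by apply: aux => //; rewrite mulrDl mul1r in g2.
  exists (n, Num.floor (z.1 * n.+1%:R), Num.floor (z.2 * n.+1%:R)).
    apply: subset_trans zA; apply: sq_sub => /=; rewrite distrC;
    by apply: le_trans (near _) _; rewrite lerBrDr -mulr2n -[leLHS]mulr_natr.
  by apply/sqP; split=> /=; exact: near.
rewrite bigcup_mkcond.
apply: countable_bigcupT_measurable => // c.
by case: ifP => _; [exact: measurable_sq|exact: measurable0].
Qed.

Definition sq_nbhd E (v : R) : set (R * R) :=
  [set z | exists x, [/\ E x, `|z.1 - x.1| < v & `|z.2 - x.2| < v]].

Lemma measurable_sq_nbhd E v : measurable (sq_nbhd E v : set (T * T)).
Proof.
apply: open_plane_measurable => z [x [Ex h1 h2]].
pose m := Num.min (v - `|z.1 - x.1|) (v - `|z.2 - x.2|).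
have m0 : 0 < m by rewrite lt_min !subr_gt0 h1.
have m1 : m <= v - `|z.1 - x.1| by rewrite ge_min lexx.
have m2 : m <= v - `|z.2 - x.2| by rewrite ge_min lexx orbT.
exists (m / 2); first by rewrite divr_gt0.
move=> w /sqP[w1 w2]; exists x; split => //.
  rewrite (_ : w.1 - x.1 = (w.1 - z.1) + (z.1 - x.1)); last by ring.
  by rewrite (le_lt_trans (ler_normD _ _))//; lra.
rewrite (_ : w.2 - x.2 = (w.2 - z.2) + (z.2 - x.2)); last by ring.
by rewrite (le_lt_trans (ler_normD _ _))//; lra.
Qed.

Lemma sq_nbhd_decr E n k : (n <= k)%N -> sq_nbhd E k.+1%:R^-1 `<=` sq_nbhd E n.+1%:R^-1.
Proof.
move=> nk z [x [Ex h1 h2]]; exists x.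
have le : k.+1%:R^-1 <= n.+1%:R^-1 :> R by rewrite lef_pV2 ?posrE// ler_nat.
by split => //; exact: lt_le_trans le.
Qed.

Lemma bigcap_sq_nbhd E : \bigcap_n sq_nbhd E n.+1%:R^-1 = closure E.
Proof.
apply/seteqP; split=> z.
  move=> Nz B /nbhs_ballP[e /= e0 eB].
  have [n _ /(_ n (leqnn n)) ne] := near_infty_natSinv_lt (PosNum e0).
  have [x [Ex h1 h2]] := Nz n I.
  exists x; split => //; apply: eB; split; rewrite /ball /=.
    exact: lt_trans h1 ne.
  exact: lt_trans h2 ne.
move=> clz n _.
have n0 : 0 < n.+1%:R^-1 :> R by [].
have [x [Ex [/= b1 b2]]] := clz _ (nbhsx_ballx z _ n0).
by exists x.
Qed.

End neighbourhoods.

(** * Comparison of the two moduli *)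

Section degenerate.
Context {R : realType}.
Implicit Types (F : set (R * R)) (p : R * R).

Lemma compact_distance F p : compact F -> ~ F p ->
  exists2 d : R, 0 < d & forall w, F w -> d <= euclidean_dist p w.
Proof.
move=> cF nFp.
have clF : closed F by apply: compact_closed => //; exact: norm_hausdorff.
have : nbhs p (~` F) by apply: open_nbhs_nbhs; split => //; exact: closed_openC.
move=> /nbhs_ballP[d /= d0 dF]; exists d => // w Fw.
rewrite leNgt; apply/negP => pwd; apply: (dF w) Fw; split; rewrite /ball /=.
  exact: le_lt_trans (edist_fst p w) pwd.
exact: le_lt_trans (edist_snd p w) pwd.
Qed.

Lemma edist_le_curve_length (g : curve R) : rectifiable g ->
  euclidean_dist (curve_start g) (curve_end g) <= fine (curve_length g).
Proof.
move=> rg; have := path_length_ge g (curve_lo_le_hi g).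
rewrite -/(curve_length g) -lee_fin fineK//.
by rewrite ge0_fin_numE// path_length_ge0// curve_lo_le_hi.
Qed.

Lemma Mod2_joining_point F1 F2 p : disjoint_continua F1 F2 ->
  F1 `<=` [set p] \/ F2 `<=` [set p] -> Mod2 (joining F1 F2) = 0%E.
Proof.
move=> [[c1 _] [c2 _] [x1 Fx1] [x2 Fx2] F12].
have disj w : F1 w -> ~ F2 w.
  by move=> h1 h2; have : (F1 `&` F2) w by []; rewrite F12.
case=> sub.
  have nF2 : ~ F2 p by rewrite -(sub _ Fx1); exact: disj.
  have [d d0 dF2] := compact_distance c2 nF2.
  apply: (Mod2_through_point (p := p) d0) => g [Fs Fe] rg; split; last by left; exact: sub.
  by rewrite (le_trans _ (edist_le_curve_length rg))// (sub _ Fs) dF2.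
have nF1 : ~ F1 p by rewrite -(sub _ Fx2) => h; exact: (disj _ h Fx2).
have [d d0 dF1] := compact_distance c1 nF1.
apply: (Mod2_through_point (p := p) d0) => g [Fs Fe] rg; split; last by right; exact: sub.
by rewrite (le_trans _ (edist_le_curve_length rg))// (sub _ Fe) edistC dF1.
Qed.

End degenerate.

Section comparison.
Context {R : realType}.
Notation mu := (@lebesgue_measure R).
Notation T := (measurableTypeR R).
Variables (E : set (R * R)).
Hypothesis hE1 : mu.-negligible (fst @` E).
Hypothesis hE2 : mu.-negligible (snd @` E).

Lemma two_points_or_point (F : set (R * R)) : F !=set0 ->
  (exists p, F `<=` [set p]) \/ (exists a b, [/\ F a, F b & a != b]).
Proof.
move=> [a Fa]; have [h|] := pselect (F `<=` [set a]); first by left; exists a.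
move=> /existsNP[b /not_implyP[Fb /eqP ba]]; right; exists a, b; split => //.
by rewrite eq_sym.
Qed.

(** The square of rho + 2 * rho \_ N is rho ^ 2 off N and 9 * rho ^ 2 on N.
   Continua reduced to a point are joined by a family of modulus zero. *)
Lemma Mod2_joining_le F1 F2 rho (N : set (R * R)) s (e : R) :
  disjoint_continua F1 F2 ->
  admissible (joining F1 F2 `&` avoiding E) rho ->
  (\int[m2 R]_z rho z ^+ 2 < +oo)%E ->
  measurable (N : set (T * T)) -> 0 < s ->
  (forall z x, E x -> `|z.1 - x.1| <= 3 * s -> `|z.2 - x.2| <= 3 * s -> N z) ->
  0 < e ->
  (Mod2 (joining F1 F2) <= (1 + e)%:E *
     (\int[m2 R]_z (rho z ^+ 2) + 8%:E * \int[m2 R]_(z in N) (rho z ^+ 2)))%E.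
Proof.
move=> dc adm rho2 mN s0 EN e0.
have [mrho rho0 _] := adm.
have mr2 : measurable_fun [set: T * T] (fun z => rho z ^+ 2)%E by exact: measurable_sqre.
have r20 z : (0 <= rho z ^+ 2)%E by exact: sqre_ge0.
have mrN : measurable_fun [set: T * T] ((fun z => rho z ^+ 2)%E \_ N).
  exact: (@measurable_patch _ (T * T)%type _ _ _ mN mr2).
have mix : (\int[m2 R]_z ((rho z + 2%:E * (rho \_ N) z) ^+ 2) =
    \int[m2 R]_z (rho z ^+ 2) + 8%:E * \int[m2 R]_(z in N) (rho z ^+ 2))%E.
  rewrite [X in (_ + 8%:E * X)%E]integral_mkcond -ge0_integralZl_EFin//; last first.
    by move=> z _; rewrite patchE; case: ifP.
  rewrite -ge0_integralD//; last 2 first.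
  - by move=> z _; rewrite mule_ge0// patchE; case: ifP.
  - exact: measurable_funeM.
  apply: eq_integral => z _; rewrite !patchE; case: ifP => _; last by rewrite !mule0 !adde0.
  have := rho0 z; case: (rho z) => [t _|_|//].
    by rewrite -EFinM -EFinD !expe2 -!EFinM -EFinD; congr EFin; ring.
  by rewrite gt0_muley ?lte_fin// addye// expe2 mulyy gt0_muley ?lte_fin// addye.
have [_ _ n1 n2 _] := dc.
have nonneg : (0 <= (1 + e)%:E *
     (\int[m2 R]_z (rho z ^+ 2) + 8%:E * \int[m2 R]_(z in N) (rho z ^+ 2)))%E.
  have e1 : (0 <= (1 + e)%:E)%E by rewrite lee_fin addr_ge0// ltW.
  have I1 : (0 <= \int[m2 R]_z (rho z ^+ 2))%E by exact: integral_ge0.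
  have I2 : (0 <= \int[m2 R]_(z in N) (rho z ^+ 2))%E by exact: integral_ge0.
  exact: mule_ge0 e1 (adde_ge0 I1 (mule_ge0 (_ : (0 <= 8%:E)%E) I2)).
have [[p sub]|[a1 [b1 [Fa1 Fb1 ab1]]]] := two_points_or_point n1.
  by rewrite (Mod2_joining_point (p := p) dc)//; left.
have [[p sub]|[a2 [b2 [Fa2 Fb2 ab2]]]] := two_points_or_point n2.
  by rewrite (Mod2_joining_point (p := p) dc)//; right.
have [[_ cF1] [_ cF2] _ _ _] := dc.
rewrite -mix.
exact: (joining_modulus_le hE1 hE2 adm rho2 cF1 cF2 Fa1 Fb1 ab1 Fa2 Fb2 ab2 mN s0 EN e0).
Qed.

End comparison.

Theorem theorem6p6 (R : realType) (E : set (R * R))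
    (hE1 : (@lebesgue_measure R).-negligible (fst @` E))
    (hE2 : (@lebesgue_measure R).-negligible (snd @` E)) :
  NEDw E /\ (m2 R (closure E) = 0%E -> NED E).
Proof.
have r20 (rho : R * R -> \bar R) z : (forall z, 0 <= rho z)%E -> (0 <= rho z ^+ 2)%E.
  by move=> rho0; exact: sqre_ge0.
split.
  (* 18 = (1 + 1) * 9, with the whole plane as neighbourhood of E *)
  exists 18; split; first by rewrite ler1n.
  move=> F1 F2 dc; rewrite -lee_pdivrMl//.
  apply: le_ereal_inf_tmp => _ [rho adm <-]; rewrite lee_pdivrMl//.
  have [mrho rho0 _] := adm.
  set S := (\int[m2 R]_z (rho z ^+ 2))%E.
  have S0 : (0 <= S)%E by apply: integral_ge0 => z _; exact: r20.
  have [->|] := eqVneq S +oo%E; first by rewrite gt0_muley ?lte_fin// leey.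
  rewrite -ltey => Sfin.
  have := @Mod2_joining_le R E hE1 hE2 F1 F2 rho setT 1 1 dc adm Sfin measurableT ltr01
    (fun _ _ _ _ _ => I) ltr01.
  move=> /le_trans; apply; rewrite -/S.
  move: S S0 Sfin => [x| |]// x0 _.
  by rewrite -!(EFinM, EFinD) lee_fin le_eqVlt; apply/orP; left; apply/eqP; ring.
move=> clE F1 F2 dc; apply/eqP; rewrite eq_le; apply/andP; split; last first.
  by apply: le_Mod2 => g [].
apply: le_ereal_inf_tmp => _ [rho adm <-].
have [mrho rho0 _] := adm.
set S := (\int[m2 R]_z (rho z ^+ 2))%E.
have S0 : (0 <= S)%E by apply: integral_ge0 => z _; exact: r20.
have [->|] := eqVneq S +oo%E; first by rewrite leey.
rewrite -ltey => Sfin; apply/lee_addgt0Pr => eps eps0.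
pose N n := sq_nbhd E n.+1%:R^-1.
have capN : m2 R (\bigcap_n N n) = 0%E by rewrite bigcap_sq_nbhd.
have eta0 : 0 < eps / 32 by rewrite divr_gt0.
have mr2 : measurable_fun [set: measurableTypeR R * measurableTypeR R] (fun z => rho z ^+ 2)%E.
  exact: measurable_sqre.
have [n In] := integral_cvg0_shrinking (fun n => measurable_sq_nbhd E _)
  (fun n k => @sq_nbhd_decr R E n k) capN mr2 (fun z => r20 rho z rho0) Sfin eta0.
(* any s with 3 * s below the radius of N n *)
pose s : R := n.+1%:R^-1 / 4.
have n0 : 0 < n.+1%:R^-1 :> R by [].
have s0 : 0 < s by rewrite divr_gt0.
have s3 : 3 * s < n.+1%:R^-1.
  by rewrite /s; move: n0; move: (n.+1%:R^-1) => v v0; lra.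
have EN z x : E x -> `|z.1 - x.1| <= 3 * s -> `|z.2 - x.2| <= 3 * s -> N n z.
  by move=> Ex h1 h2; exists x; split => //; [exact: le_lt_trans h1 s3|exact: le_lt_trans h2 s3].
have fS : S = (fine S)%:E by rewrite fineK// ge0_fin_numE.
have S0' : 0 <= fine S by exact: fine_ge0.
(* chosen so that (1 + e) * (S + 8 * (eps / 32)) <= S + eps *)
pose e : R := Num.min 1 (eps / (2 * (fine S + 1))).
have S1 : 0 < fine S + 1 by rewrite ltr_wpDl.
have e0 : 0 < e by rewrite lt_min ltr01 divr_gt0// mulr_gt0.
have e1 : e <= 1 by rewrite ge_min lexx.
have eS : e * (2 * (fine S + 1)) <= eps by rewrite -ler_pdivlMr ?mulr_gt0// ge_min lexx orbT.
have := @Mod2_joining_le R E hE1 hE2 F1 F2 rho (N n) s e dc adm Sfin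
  (measurable_sq_nbhd E _) s0 EN e0.
move=> /le_trans; apply; rewrite -/S.
apply: (@le_trans _ _ ((1 + e)%:E * (S + 8%:E * (eps / 32)%:E))%E).
  apply: lee_wpmul2l; first by rewrite lee_fin addr_ge0// ltW.
  by apply: leeD => //; apply: lee_wpmul2l => //; rewrite lee_fin.
rewrite fS -!(EFinM, EFinD) lee_fin; nra.
Qed.
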